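(* Let $\sigma$ be the even, antilinear superalgebra-morphism of $\mathrm{Hol}(SL(n,m,\mathbb{C}))$ determined on the generators by $$\sigma(x_{ij})=(-1)^{(|i|+|j|)|j|}\,S(x_{ji}),\qquad i,j=1,\dots,n+m .$$ Then $(\mathrm{Hol}(SL(n,m,\mathbb{C})),\sigma)$ is a graded real form of $SL(n,m,\mathbb{C})$, i.e. for all $x,y$ and all $\lambda,\mu\in\mathbb{C}$: (1) $(\sigma\otimes\sigma)\Delta(x)=\Delta(\sigma(x))$; (2) $\epsilon(\sigma(x))=\overline{\epsilon(x)}$; (3) $\sigma(\lambda x+\mu y)=\bar\lambda\sigma(x)+\bar\mu\sigma(y)$; (4) $\sigma(xy)=\sigma(x)\sigma(y)$; (5b) $S\circ\sigma\circ S\circ\sigma(x)=(-1)^{|x|}x$ for homogeneous $x$; (6b) $\sigma(\sigma(x))=(-1)^{|x|}x$ for homogeneous $x$.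
   Context: Fix integers $n,m\ge 0$. For an index $i\in\{1,\dots,n+m\}$ set $|i|=0$ if $i\le n$ and $|i|=1$ if $i>n$. Let $\mathbb{C}[x_{ij}]$ ($i,j=1,\dots,n+m$) be the supercommutative complex superalgebra of formal power series in generators $x_{ij}$ of parity $|x_{ij}|=|i|+|j| \pmod 2$, with $x_{ij}x_{kl}=(-1)^{(|i|+|j|)(|k|+|l|)}x_{kl}x_{ij}$. It is a superbialgebra with coproduct and counit given on generators by $\Delta(x_{ij})=1\otimes x_{ij}+x_{ij}\otimes 1+\sum_{k=1}^{n+m}x_{ik}\otimes x_{kj}$ (equivalently $\Delta(y_{ij})=\sum_k y_{ik}\otimes y_{kj}$ with $y_{ij}=\delta_{ij}+x_{ij}$), $\epsilon(x_{ij})=0$, extended as (super)algebra morphisms. $\mathrm{Hol}(SL(n,m,\mathbb{C}))$ is the quotient of $\mathbb{C}[x_{ij}]$ by the ideal generated by $\mathrm{sdet}(\delta+x)-1$, where for a supermatrix $\begin{pmatrix}A&B\\C&D\end{pmatrix}$ (blocks of sizes $n,m$) $\mathrm{sdet}=\det(A-BD^{-1}C)/\det(D)$. Its antipode $S$ is the superalgebra-antimorphism ($S(ab)=(-1)^{|a||b|}S(b)S(a)$) given by $S(x_{ij})=-\delta_{ij}+((\delta+x)^{-1})_{ij}$, where the supermatrix inverse is $\begin{pmatrix}A&B\\C&D\end{pmatrix}^{-1}=\begin{pmatrix}(A-BD^{-1}C)^{-1}&-A^{-1}B(D-CA^{-1}B)^{-1}\\-D^{-1}C(A-BD^{-1}C)^{-1}&(D-CA^{-1}B)^{-1}\end{pmatrix}$.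 A graded real form of a complex Lie supergroup (Hopf superalgebra) $\mathcal H$ is a pair $(\mathcal H,\sigma)$ with $\sigma:\mathcal H\to\mathcal H$ an even map satisfying (1),(2),(3),(4),(5b),(6b) above. *)

(* Defs.v *)
(* MathComp (+ mathcomp-real-closed complex numbers over Stdlib's R). *)
From mathcomp Require Import all_boot all_order all_algebra all_fingroup complex.
From mathcomp Require Import Rstruct.
Set Implicit Arguments. Unset Strict Implicit. Unset Printing Implicit Defensive.
Import Order.TTheory GRing.Theory Num.Theory.
Local Open Scope ring_scope.

(* The complex numbers. *)
Definition CC : numClosedFieldType := (Rdefinitions.R)[i].

(* Supercommutative formal power series over CC in finitely many generators *)
(* indexed by a finType T, with parity par : T -> bool.  A series is the     *)
(* function e |-> coefficient of the ordered monomial                        *)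
(*     x^e = prod_{v in enum T (in this order)} x_v ^ (e v).                 *)
(* Series that really belong to the algebra ("valid" ones) vanish on          *)
(* monomials in which an odd generator occurs at least twice.                 *)

Definition mon (T : finType) := {ffun T -> nat}.
Definition ser (T : finType) := mon T -> CC.

Section Series.
Variables (T : finType) (par : T -> bool).

Definition mon0 : mon T := [ffun _ => 0%N].
Definition mdeg (e : mon T) : nat := (\sum_(v : T) e v)%N.
Definition msub (k e : mon T) : mon T := [ffun v => (k v - e v)%N].
(* parity of a monomial *)
Definition mpar (e : mon T) : bool := odd (\sum_(v : T | par v) e v)%N.

Definition svalid (f : ser T) : Prop :=
  forall (e : mon T) (v : T), par v -> (1 < e v)%N -> f e = 0.
Definition shomog (p : bool) (f : ser T) : Prop :=
  forall e : mon T, f e != 0 -> mpar e = p.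

(* sign in x^e * x^f = msign e f * x^(e+f) *)
Definition msign (e f : mon T) : CC :=
  if [exists v, [&& par v, (0 < e v)%N & (0 < f v)%N]] then 0
  else (-1) ^+ (\sum_(v : T | par v) \sum_(w : T | par w && (enum_rank w < enum_rank v)%N)
                  (e v * f w))%N.

Definition szero : ser T := fun _ => 0.
Definition sconst (c : CC) : ser T := fun e => if e == mon0 then c else 0.
Definition sone : ser T := sconst 1.
Definition svar (v : T) : ser T :=
  fun e => if e == [ffun w => (w == v : nat)] then 1 else 0.
Definition sadd (f g : ser T) : ser T := fun e => f e + g e.
Definition sopp (f : ser T) : ser T := fun e => - f e.
Definition ssub (f g : ser T) : ser T := sadd f (sopp g).
Definition sscale (c : CC) (f : ser T) : ser T := fun e => c * f e.
Definition ssum (I : finType) (F : I -> ser T) : ser T := fun e => \sum_(i : I) F i e.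

(* the product: sum over the (finitely many) monomials e <= k *)
Definition mbnd (k : mon T) : nat := (\max_(v : T) k v)%N.
Definition smul (f g : ser T) : ser T := fun k =>
  \sum_(d : {ffun T -> 'I_(mbnd k).+1} | [forall v, (d v <= k v)%N])
     (let e : mon T := [ffun v => nat_of_ord (d v)] in
      msign e (msub k e) * f e * g (msub k e)).

Definition spow (f : ser T) (t : nat) : ser T := iter t (smul f) sone.
Definition sprodl (s : seq (ser T)) : ser T := foldr smul sone s.

(* counit = constant term *)
Definition seps (f : ser T) : CC := f mon0.

(* sum of a family F t whose coefficients vanish in degree < t *)
Definition ssum_inf (F : nat -> ser T) : ser T := fun k =>
  \sum_(t < (mdeg k).+1) F t k.

(* inverse of a series with invertible constant term *)
Definition sinv (u : ser T) : ser T :=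
  let c := u mon0 in
  sscale c^-1 (ssum_inf (spow (ssub sone (sscale c^-1 u)))).

(* ---- square matrices with series entries ---- *)
Definition smx (p : nat) := 'I_p -> 'I_p -> ser T.
Definition mx1 (p : nat) : smx p := fun i j => sconst (i == j)%:R.
Definition mxadd (p : nat) (M N : smx p) : smx p := fun i j => sadd (M i j) (N i j).
Definition mxopp (p : nat) (M : smx p) : smx p := fun i j => sopp (M i j).
Definition mxmul (a b c : nat) (M : 'I_a -> 'I_b -> ser T) (N : 'I_b -> 'I_c -> ser T) :
  'I_a -> 'I_c -> ser T := fun i k => ssum (fun j => smul (M i j) (N j k)).
Definition mxpow (p : nat) (M : smx p) (t : nat) : smx p := iter t (mxmul M) (@mx1 p).
(* inverse of a matrix whose constant part is the identity (Neumann series);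
   this is the only kind of matrix inverted below *)
Definition mxinv (p : nat) (M : smx p) : smx p :=
  fun i j => ssum_inf (fun t => mxpow (mxadd (@mx1 p) (mxopp M)) t i j).
(* Leibniz determinant, for matrices with even (hence central) entries *)
Definition mxdet (p : nat) (M : smx p) : ser T :=
  ssum (fun s : 'S_p => sscale ((-1) ^+ odd_perm s) (sprodl [seq M i (s i) | i <- enum 'I_p])).

End Series.
Arguments szero {T}.
Arguments sconst {T}.
Arguments sone {T}.
Arguments mx1 {T p}.

Section Subst.
Variables (T U : finType) (parU : U -> bool).
(* The continuous (super)algebra morphism C[[x_T]] -> C[[x_U]] sending x_v to h v
   (h v with zero constant term); with conjugated coefficients: antilinear version. *)
Definition subst_gen (cj : CC -> CC) (f : ser T) (h : T -> ser U) : ser U := fun k =>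
  \sum_(d : {ffun T -> 'I_(mdeg k).+1})
     (let e : mon T := [ffun v => nat_of_ord (d v)] in
      cj (f e) * sprodl parU [seq spow parU (h v) (e v) | v <- enum T] k).
Definition subst := subst_gen id.
Definition csubst := subst_gen (fun c => c^*).
(* The (even) algebra ANTImorphism sending x_v to h v :
   x_{v1}...x_{vr} |-> (-1)^{sum_{a<b} |v_a||v_b|} h(v_r)...h(v_1). *)
Definition antisubst (parT : T -> bool) (f : ser T) (h : T -> ser U) : ser U := fun k =>
  \sum_(d : {ffun T -> 'I_(mdeg k).+1})
     (let e : mon T := [ffun v => nat_of_ord (d v)] in
      let o := (\sum_(v : T | parT v) e v)%N in
      f e * (-1) ^+ 'C(o, 2) *
      sprodl parU [seq spow parU (h v) (e v) | v <- rev (enum T)] k).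
End Subst.

(*                      Hol(SL(n,m,C)) and its structure maps                *)
Section SL.
Variables n m : nat.

Definition idx := 'I_(n + m).
Definition ipar (i : idx) : bool := (n <= i)%N.            (* |i| *)
Definition V : finType := (idx * idx)%type.                (* generators x_ij *)
Definition vpar (v : V) : bool := ipar v.1 (+) ipar v.2.   (* |x_ij| *)
Definition V2 : finType := (V + V)%type.                   (* generators of the tensor square *)
Definition vpar2 (w : V2) : bool := match w with inl v => vpar v | inr v => vpar v end.

Definition X (i j : idx) : ser V := svar (i, j).
Definition Y : smx V (n + m) := fun i j => sadd (sconst (i == j)%:R) (X i j).  (* delta + x *)

Definition blkA : smx V n := fun i j => Y (lshift m i) (lshift m j).
Definition blkB : 'I_n -> 'I_m -> ser V := fun i j => Y (lshift m i) (rshift n j).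
Definition blkC : 'I_m -> 'I_n -> ser V := fun i j => Y (rshift n i) (lshift m j).
Definition blkD : smx V m := fun i j => Y (rshift n i) (rshift n j).

Definition Dinv := mxinv vpar blkD.
Definition Ainv := mxinv vpar blkA.
(* A - B D^{-1} C  and  D - C A^{-1} B *)
Definition SchurA : smx V n := mxadd blkA (mxopp (mxmul vpar (mxmul vpar blkB Dinv) blkC)).
Definition SchurD : smx V m := mxadd blkD (mxopp (mxmul vpar (mxmul vpar blkC Ainv) blkB)).

(* superdeterminant sdet(delta + x) = det(A - B D^-1 C) / det D *)
Definition sdetY : ser V := smul vpar (mxdet vpar SchurA) (sinv vpar (mxdet vpar blkD)).
(* generator of the defining ideal of Hol(SL(n,m,C)) *)
Definition gSL : ser V := ssub sdetY sone.

(* supermatrix inverse of delta + x *)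
Definition Yinv : smx V (n + m) := fun i j =>
  match split i, split j with
  | inl a, inl b => mxinv vpar SchurA a b
  | inl a, inr b => sopp (mxmul vpar (mxmul vpar Ainv blkB) (mxinv vpar SchurD) a b)
  | inr a, inl b => sopp (mxmul vpar (mxmul vpar Dinv blkC) (mxinv vpar SchurA) a b)
  | inr a, inr b => mxinv vpar SchurD a b
  end.

(* antipode *)
Definition S_gen (v : V) : ser V := sadd (sconst (- (v.1 == v.2)%:R)) (Yinv v.1 v.2).
Definition Santi (f : ser V) : ser V := antisubst vpar vpar f S_gen.

(* sigma(x_ij) = (-1)^{(|i|+|j|)|j|} S(x_ji), extended as antilinear morphism *)
Definition sigma_gen (v : V) : ser V :=
  sscale ((-1) ^+ (vpar v && ipar v.2)) (S_gen (v.2, v.1)).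
Definition sigma (f : ser V) : ser V := csubst vpar f sigma_gen.

(* C[[x]] (x) C[[x]] (completed super tensor product) is identified with C[[x, x']],
   a (x) b |-> a(x) * b(x') ; the left copy uses inl generators, the right copy inr. *)
Definition embL (f : ser V) : ser V2 := subst vpar2 f (fun v => svar (inl v)).
Definition embR (f : ser V) : ser V2 := subst vpar2 f (fun v => svar (inr v)).

(* coproduct: Delta(x_ij) = x_ij (x) 1 + 1 (x) x_ij + sum_k x_ik (x) x_kj *)
Definition Delta_gen (v : V) : ser V2 :=
  sadd (sadd (svar (inl v)) (svar (inr v)))
       (ssum (fun k : idx => smul vpar2 (svar (inl (v.1, k))) (svar (inr (k, v.2))))).
Definition Delta (f : ser V) : ser V2 := subst vpar2 f Delta_gen.

(* sigma (x) sigma : the antilinear morphism a (x) b |-> sigma a (x) sigma b *)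
Definition sigma2 (F : ser V2) : ser V2 :=
  csubst vpar2 F (fun w => match w with inl v => embL (sigma_gen v)
                                      | inr v => embR (sigma_gen v) end).

(* membership in the ideal (gSL) of C[[x]], resp. (gSL (x) 1, 1 (x) gSL) of C[[x,x']] *)
Definition inI (f : ser V) : Prop :=
  exists a : ser V, svalid vpar a /\ f = smul vpar a gSL.
Definition inI2 (F : ser V2) : Prop :=
  exists a b : ser V2, [/\ svalid vpar2 a, svalid vpar2 b &
    F = sadd (smul vpar2 a (embL gSL)) (smul vpar2 b (embR gSL))].
End SL.

(* Main.v *)
(* Put Y = delta + x.  As the algebra is supercommutative, the graded antimorphism S is also a
   morphism, so S, sigma and Delta are continuous (semi)linear morphisms, determined by
       S(Y) = Y^-1,   sigma(Y) = (Y^-1)^st,   Delta(Y) = (Y (x) 1)(1 (x) Y),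
   where the supertranspose st reverses products of even supermatrices and satisfies
   (M^st)^st_ij = (-1)^(|i|+|j|) M_ij.  All the identities thus hold before passing to the
   quotient, and it is enough to check them on Y.  The ideal only enters through
   sigma(sdet Y) * sdet Y = 1.  Comparing the blocks of sigma(Y) with those of Y^-1, this
   amounts to det(A - B D^-1 C) det(D - C A^-1 B) = det A det D, that is to
   det(1 - PQ) det(1 - QP) = 1 for odd P = A^-1 B and Q = D^-1 C, which is proved by a Schur
   complement, splitting off one column of P and one row of Q at a time. *)

(* A power series is not a polynomial in the generators, so a check on Y settles an identity only
   for continuous maps. Each map is therefore bundled with its compatibility with the filtration by
   total degree, and equalities are tested on truncations. Agreement on generators extends to valid
   series only: the monomial series of an exponent with a repeated odd generator is nonzero, but it
   is not a product of generators.

   The signs of (5b) and (6b) depend on the argument. Turning f |-> (-1)^|f| f into a morphism of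
   its own, [sm_sgn], makes both identities equalities of morphisms, and on Y this morphism is the
   double supertranspose.

   Series do not commute, so determinants are computed in the commutative subring of even series.
   This shapes the proof of det(1 - PQ) det(1 - QP) = 1: the block matrix with off-diagonal blocks P
   and Q, from which the commutative identity of Sylvester is read off, has odd entries, and only
   the products of P and Q may enter a determinant. *)
Require Import Defs.
From HB Require Import structures.
From mathcomp Require Import all_boot all_order all_algebra all_fingroup complex.
From mathcomp Require Import boolp ring.
Import GRing.Theory Num.Theory.
Set Implicit Arguments. Unset Strict Implicit. Unset Printing Implicit Defensive.
Local Open Scope ring_scope.

(** * Monomials and signs *)

Section Monomials.
Variable T : finType.
Implicit Types (a b k : mon T) (N : nat).

Definition box_mon N (d : {ffun T -> 'I_N.+1}) : mon T := [ffun v => nat_of_ord (d v)].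
Definition inbox N a := [forall v, (a v <= N)%N].
(** The definitions sum over exponents bounded by a number attached to the coefficient being
    computed. With the bound as a parameter it can be enlarged ([bsum_widen]), so that nested
    products are summed over one common box. *)
Definition bsum (A : nmodType) N (F : mon T -> A) : A :=
  \sum_(d : {ffun T -> 'I_N.+1}) F (box_mon d).
Definition madd a b : mon T := [ffun v => (a v + b v)%N].
Definition mdelta (v : T) : mon T := [ffun w => (w == v : nat)].

Lemma maddC : commutative madd.
Proof. by move=> a b; apply/ffunP => v; rewrite !ffunE addnC. Qed.

Lemma maddA : associative madd.
Proof. by move=> a b c; apply/ffunP => v; rewrite !ffunE addnA. Qed.

Lemma madd0 a : madd a (mon0 T) = a.
Proof. by apply/ffunP => v; rewrite !ffunE addn0. Qed.

Lemma mdeg0 : mdeg (mon0 T) = 0%N.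
Proof. by apply: big1 => v _; rewrite ffunE. Qed.

Lemma mdeg_eq0 a : mdeg a = 0%N -> a = mon0 T.
Proof.
move=> /eqP; rewrite sum_nat_eq0 => /forallP a0.
by apply/ffunP => v; rewrite ffunE; apply/eqP/(implyP (a0 v)).
Qed.

Lemma mdegD a b : mdeg (madd a b) = (mdeg a + mdeg b)%N.
Proof. by rewrite /mdeg -big_split; apply: eq_bigr => v _; rewrite ffunE. Qed.

Lemma mdeg_delta v : mdeg (mdelta v) = 1%N.
Proof.
rewrite /mdeg (bigD1 v) //= big1 ?addn0 ?ffunE ?eqxx // => w /negPf wv.
by rewrite ffunE wv.
Qed.

Lemma leq_mdeg a v : (a v <= mdeg a)%N.
Proof. by rewrite /mdeg (bigD1 v) //= leq_addr. Qed.

Lemma inbox_mdeg N a : (mdeg a <= N)%N -> inbox N a.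
Proof. by move=> aN; apply/forallP => v; apply: leq_trans (leq_mdeg a v) aN. Qed.

Lemma inbox_mbnd a : inbox (mbnd a) a.
Proof. by apply/forallP => v; apply: (leq_bigmax (F := fun v => a v)). Qed.

Lemma inboxDl N a b : inbox N (madd a b) -> inbox N a.
Proof.
move=> /forallP ab; apply/forallP => v; apply: leq_trans (ab v).
by rewrite ffunE leq_addr.
Qed.

Lemma box_mon_inbox N (d : {ffun T -> 'I_N.+1}) : inbox N (box_mon d).
Proof. by apply/forallP => v; rewrite ffunE -ltnS. Qed.

Lemma box_mon_inj N : injective (@box_mon N).
Proof. by move=> d d' /ffunP dd'; apply/ffunP => v; apply/val_inj; have := dd' v; rewrite !ffunE. Qed.

Lemma inboxP N a : inbox N a -> exists d : {ffun T -> 'I_N.+1}, box_mon d = a.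
Proof.
move=> /forallP aN; exists [ffun v => inord (a v)].
by apply/ffunP => v; rewrite !ffunE inordK // ltnS.
Qed.

Section BoxSums.
Variable A : nmodType.
Implicit Types (F G : mon T -> A).

Lemma eq_bsum N F G : (forall a, inbox N a -> F a = G a) -> bsum N F = bsum N G.
Proof. by move=> FG; apply: eq_bigr => d _; apply/FG/box_mon_inbox. Qed.

Lemma bsum0 N F : (forall a, inbox N a -> F a = 0) -> bsum N F = 0.
Proof. by move=> F0; apply: big1 => d _; apply/F0/box_mon_inbox. Qed.

Lemma bsum_delta N k F :
  bsum N (fun a => if a == k then F a else 0) = if inbox N k then F k else 0.
Proof.
case: ifP => [/inboxP[d <-]|/negP kN].
  rewrite /bsum (bigD1 d) //= eqxx big1 ?addr0 // => d' /negPf dd'.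
  by rewrite (inj_eq (@box_mon_inj N)) dd'.
by apply: big1 => d _; case: eqP => // dk; case: kN; rewrite -dk box_mon_inbox.
Qed.

Lemma bsum_widen N M F : (N <= M)%N -> (forall a, ~~ inbox N a -> F a = 0) ->
  bsum N F = bsum M F.
Proof.
move=> NM F0; symmetry; rewrite /bsum (bigID (fun d => inbox N (box_mon d))) /=.
rewrite [X in _ + X]big1 ?addr0; last by move=> d; apply: F0.
pose w (d : {ffun T -> 'I_N.+1}) : {ffun T -> 'I_M.+1} := [ffun v => inord (d v)].
pose u (d : {ffun T -> 'I_M.+1}) : {ffun T -> 'I_N.+1} := [ffun v => inord (d v)].
have bw d : box_mon (w d) = box_mon d.
  by apply/ffunP => v; rewrite !ffunE inordK // ltnS; apply: leq_trans NM; rewrite -ltnS.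
rewrite (reindex_onto w u) /=; last first.
  move=> d /forallP dN; apply/ffunP => v; apply/val_inj; rewrite !ffunE.
  have := dN v; rewrite ffunE => dv.
  by rewrite [X in inord X]inordK ?ltnS //= inordK.
apply: eq_big => [d|d _]; last by rewrite bw.
rewrite bw box_mon_inbox; apply/eqP/ffunP => v; apply/val_inj; rewrite !ffunE.
by rewrite [X in inord X]inordK /= ?inordK // ltnS; apply: leq_trans NM; rewrite -ltnS.
Qed.

Lemma exchange_bsum N M (F : mon T -> mon T -> A) :
  bsum N (fun a => bsum M (F a)) = bsum M (fun b => bsum N (F^~ b)).
Proof. exact: exchange_big. Qed.

End BoxSums.

Lemma mulr_bsumr (R : pzRingType) N (x : R) F : x * bsum N F = bsum N (fun a => x * F a).
Proof. exact: mulr_sumr. Qed.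

Lemma mulr_bsuml (R : pzRingType) N (x : R) F : bsum N F * x = bsum N (fun a => F a * x).
Proof. exact: mulr_suml. Qed.

Section Sign.
Variable par : T -> bool.

(** [mover] detects a common odd generator, whose square is zero; [mexp] counts the inversions among
    odd factors when x^a x^b is sorted. *)
Definition mover a b := [exists v, [&& par v, (0 < a v)%N & (0 < b v)%N]].
Definition mexp a b : nat :=
  (\sum_(v : T | par v) \sum_(w : T | par w && (enum_rank w < enum_rank v)%N) (a v * b w))%N.

Lemma msignE a b : msign par a b = if mover a b then 0 else (-1) ^+ mexp a b.
Proof. by []. Qed.

Lemma mexpDl a b c : mexp (madd a b) c = (mexp a c + mexp b c)%N.
Proof.
rewrite /mexp -big_split; apply: eq_bigr => v _; rewrite -big_split.
by apply: eq_bigr => w _; rewrite ffunE mulnDl.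
Qed.

Lemma mexpDr a b c : mexp c (madd a b) = (mexp c a + mexp c b)%N.
Proof.
rewrite /mexp -big_split; apply: eq_bigr => v _; rewrite -big_split.
by apply: eq_bigr => w _; rewrite ffunE mulnDr.
Qed.

Lemma moverDl a b c : mover (madd a b) c = mover a c || mover b c.
Proof.
apply/existsP/orP => [[v]|[]/existsP[v /and3P[pv av cv]]].
- rewrite ffunE addn_gt0 => /and3P[pv /orP[av|bv] cv]; [left|right];
    by apply/existsP; exists v; apply/and3P.
- by exists v; rewrite pv cv ffunE addn_gt0 av.
- by exists v; rewrite pv cv ffunE addn_gt0 av orbT.
Qed.

Lemma moverC a b : mover a b = mover b a.
Proof. by apply: eq_existsb => v; rewrite [(_ < a v)%N && _]andbC. Qed.

Lemma moverDr a b c : mover c (madd a b) = mover c a || mover c b.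
Proof. by rewrite moverC moverDl ![mover c _]moverC. Qed.

(** The inversion count is additive in each argument, so both exponents equal mexp a b + mexp a c +
    mexp b c; both sides are zero as soon as two of the three monomials overlap. *)
Lemma msign_cocycle a b c :
  msign par a b * msign par (madd a b) c = msign par a (madd b c) * msign par b c.
Proof.
rewrite !msignE moverDl moverDr.
case: (mover a b); case: (mover a c); case: (mover b c); rewrite /= ?mul0r ?mulr0 //.
by rewrite -!exprD mexpDl mexpDr addnA.
Qed.

Lemma mover0 a : mover (mon0 T) a = false.
Proof. by apply/existsP => -[v]; rewrite ffunE ltnn andbF. Qed.

Lemma mexp0l a : mexp (mon0 T) a = 0%N.
Proof. by apply: big1 => v _; apply: big1 => w _; rewrite ffunE. Qed.

Lemma mexp0r a : mexp a (mon0 T) = 0%N.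
Proof. by apply: big1 => v _; apply: big1 => w _; rewrite ffunE muln0. Qed.

Lemma msign0l a : msign par (mon0 T) a = 1.
Proof. by rewrite msignE mover0 mexp0l. Qed.

Lemma msign0r a : msign par a (mon0 T) = 1.
Proof. by rewrite msignE moverC mover0 mexp0r. Qed.

Lemma mparD a b : mpar par (madd a b) = mpar par a (+) mpar par b.
Proof.
rewrite /mpar -oddD -big_split; congr odd.
by apply: eq_bigr => v _; rewrite ffunE.
Qed.

Lemma mpar0 : mpar par (mon0 T) = false.
Proof. by rewrite /mpar big1 // => v _; rewrite ffunE. Qed.

Lemma mpar_delta v : mpar par (mdelta v) = par v.
Proof.
rewrite /mpar big_mkcond (bigD1 v) //= big1 => [|w /negPf wv].
  by rewrite ffunE eqxx addn0; case: (par v).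
by rewrite ffunE wv; case: ifP.
Qed.

(** Once its two sums are exchanged, [mexp b a] counts the pairs in the opposite order. The two
    counts then cover all pairs of odd factors except those with equal generators, which contribute
    zero when nothing overlaps. *)
Lemma mexpC a b : ~~ mover a b ->
  (mexp a b + mexp b a = (\sum_(v | par v) a v) * (\sum_(v | par v) b v))%N.
Proof.
move=> Hab.
have -> : mexp b a = (\sum_(v | par v) \sum_(w | par w && (enum_rank v < enum_rank w)%N) a v * b w)%N.
  rewrite /mexp (exchange_big_dep par) /=; last by move=> v w _ /andP[].
  apply: eq_bigr => v pv; apply: eq_big => [w|w _]; first by rewrite pv.
  by rewrite mulnC.
rewrite -big_split big_distrl /=; apply: eq_bigr => v pv; rewrite big_distrr /=.
rewrite [RHS](bigID (fun w => (enum_rank w < enum_rank v)%N)) /=; congr addn.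
rewrite [RHS](bigID (fun w => w == v)) /= [X in (_ = X + _)%N]big1 ?add0n.
  apply: eq_bigl => w; rewrite -andbA; congr andb.
  rewrite -leqNgt [RHS]andbC ltn_neqAle; congr andb.
  by rewrite eq_sym (inj_eq val_inj) (inj_eq enum_rank_inj).
move=> w /andP[_ /eqP->].
have : ~~ ((0 < a v) && (0 < b v))%N.
  by apply: contra Hab => vv; apply/existsP; exists v; rewrite pv.
by rewrite negb_and -!eqn0Ngt => /orP[/eqP->|/eqP->]; rewrite ?muln0.
Qed.

Lemma msignC a b : msign par a b = (-1) ^+ (mpar par a && mpar par b) * msign par b a.
Proof.
rewrite !msignE [mover b a]moverC; case: ifPn => [|/mexpC e]; first by rewrite mulr0.
apply: (mulIr (x := (-1) ^+ mexp b a)); first exact: unitrX (unitrN1 _).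
rewrite -mulrA -expr2 sqrr_sign mulr1 -exprD e.
by rewrite -[LHS]signr_odd oddM.
Qed.

End Sign.
End Monomials.

(* The product is associative and supercommutative on all series, valid or not, so that no
   subtype is needed: a product in which an odd generator occurs twice vanishes anyway. *)
Definition sring (T : finType) (par : T -> bool) : Type := ser T.

(** * The ring of series *)

Section SeriesRing.
Variables (T : finType) (par : T -> bool).
Notation R := (sring par).
Implicit Types (f g h : R) (k : mon T).

Lemma serP f g : (forall k, f k = g k) -> f = g.
Proof. exact: funext. Qed.

HB.instance Definition _ := gen_eqMixin R.
HB.instance Definition _ := gen_choiceMixin R.

Fact saddA : associative (@sadd T). Proof. by move=> f g h; apply: serP => k; apply: addrA. Qed.
Fact saddC : commutative (@sadd T). Proof. by move=> f g; apply: serP => k; apply: addrC. Qed.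
Fact sadd0 : left_id szero (@sadd T). Proof. by move=> f; apply: serP => k; apply: add0r. Qed.
Fact saddN : left_inverse szero (@sopp T) (@sadd T).
Proof. by move=> f; apply: serP => k; apply: addNr. Qed.

HB.instance Definition _ := GRing.isZmodule.Build R saddA saddC sadd0 saddN.

(** Symmetric form of the product: a condition on the pair replaces the subtraction in [msub k a],
    and any box containing [k] may serve. Associativity and supercommutativity are both read off
    from it. *)
Lemma smul_coef N f g k : inbox N k ->
  smul par f g k = bsum N (fun a => bsum N (fun b =>
    if madd a b == k then msign par a b * f a * g b else 0)).
Proof.
move=> kN; set P := fun a : mon T => [forall v, (a v <= k v)%N].
pose F a := if P a then msign par a (msub k a) * f a * g (msub k a) else 0.
have -> : smul par f g k = bsum (mbnd k) F.
  rewrite /smul big_mkcond; apply: eq_bigr => d _; rewrite /F.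
  by congr (if _ then _ else _); apply: eq_forallb => v; rewrite ffunE.
have F0 M a : inbox M k -> ~~ inbox M a -> F a = 0.
  move=> kM; rewrite /F; case: ifP => // /forallP ak /negP[]; apply/forallP => v.
  exact: leq_trans (ak v) (forallP kM v).
have -> : bsum (mbnd k) F = bsum N F.
  apply: bsum_widen; last by move=> a; apply/F0/inbox_mbnd.
  by apply/bigmax_leqP => v _; apply: (forallP kN).
apply: eq_bsum => a _.
transitivity (bsum N (fun b => if b == msub k a then F a else 0)).
  rewrite bsum_delta; case: ifP => // /negP[]; apply/forallP => v; rewrite ffunE.
  exact: leq_trans (leq_subr _ _) (forallP kN v).
apply: eq_bsum => b _; rewrite /F.
have [ab_k|/eqP ab_k] := altP (madd a b =P k).
  have eb : b = msub k a by apply/ffunP => v; rewrite -ab_k !ffunE addKn.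
  rewrite eb eqxx ifT //; apply/forallP => v; rewrite -ab_k ffunE; exact: leq_addr.
case: ifP => // /eqP eb; case: ifP => // /forallP ak; case: ab_k.
by apply/ffunP => v; rewrite eb !ffunE subnKC.
Qed.

Fact smulDl : left_distributive (smul par) (@sadd T).
Proof.
move=> f g h; apply: serP => k; rewrite /smul /sadd /= -big_split.
by apply: eq_bigr => d _ /=; rewrite mulrDr mulrDl.
Qed.

Fact smulDr : right_distributive (smul par) (@sadd T).
Proof.
move=> f g h; apply: serP => k; rewrite /smul /sadd /= -big_split.
by apply: eq_bigr => d _ /=; rewrite mulrDr.
Qed.

Fact smul1f : left_id sone (smul par).
Proof.
move=> f; apply: serP => k; rewrite (smul_coef _ _ (inbox_mbnd k)).
transitivity (bsum (mbnd k) (fun a => if a == mon0 T then f k else 0)); last first.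
  by rewrite bsum_delta ifT //; apply/forallP => v; rewrite ffunE.
apply: eq_bsum => a _; rewrite /sone /sconst; have [->|_] := altP eqP.
  transitivity (bsum (mbnd k) (fun b => if b == k then f b else 0)).
    by apply: eq_bsum => b _; rewrite maddC madd0 msign0l !mul1r.
  by rewrite bsum_delta inbox_mbnd.
by apply: bsum0 => b _; case: ifP => // _; rewrite mulr0 mul0r.
Qed.

Fact smulf1 : right_id sone (smul par).
Proof.
move=> f; apply: serP => k; rewrite (smul_coef _ _ (inbox_mbnd k)) exchange_bsum.
transitivity (bsum (mbnd k) (fun a => if a == mon0 T then f k else 0)); last first.
  by rewrite bsum_delta ifT //; apply/forallP => v; rewrite ffunE.
apply: eq_bsum => a _; rewrite /sone /sconst; have [->|_] := altP eqP.
  transitivity (bsum (mbnd k) (fun b => if b == k then f b else 0)).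
    by apply: eq_bsum => b _; rewrite madd0 msign0r mul1r mulr1.
  by rewrite bsum_delta inbox_mbnd.
by apply: bsum0 => b _; case: ifP => // _; rewrite mulr0.
Qed.

(** Both sides become the same sum over triples of monomials once the intermediate monomial [c] is
    summed out. A [c] outside the box contributes nothing, since it would not divide x^k. *)
Fact smulA : associative (smul par).
Proof.
move=> f g h; apply: serP => k; have kN := inbox_mbnd k; set N := mbnd k in kN *.
pose W x y z := if madd (madd x y) z == k then
  msign par x y * msign par (madd x y) z * f x * g y * h z else 0.
transitivity (bsum N (fun x => bsum N (fun y => bsum N (fun z => W x y z)))).
  rewrite (smul_coef _ _ kN); apply: eq_bsum => x _.
  transitivity (bsum N (fun c => bsum N (fun y => bsum N (fun z =>
      if c == madd y z then W x y z else 0)))).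
    apply: eq_bsum => c cN; rewrite (smul_coef _ _ cN) /W.
    have [xc|xc] := eqP; last first.
      symmetry; apply: bsum0 => y _; apply: bsum0 => z _; case: ifP => // /eqP ec.
      by rewrite -maddA -ec; case: eqP.
    rewrite mulr_bsumr; apply: eq_bsum => y _; rewrite mulr_bsumr.
    apply: eq_bsum => z _; rewrite [c == _]eq_sym.
    have [ec|_] := eqP; last by rewrite mulr0.
    by rewrite -maddA ec xc eqxx msign_cocycle ec; ring.
  rewrite exchange_bsum; apply: eq_bsum => y _.
  rewrite exchange_bsum; apply: eq_bsum => z _.
  rewrite bsum_delta; case: ifPn => // yzN; rewrite /W; case: eqP => // e.
  by case/negP: yzN; move: kN; rewrite -e -maddA maddC => /inboxDl.
symmetry; rewrite (smul_coef _ _ kN).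
transitivity (bsum N (fun c => bsum N (fun z => bsum N (fun x => bsum N (fun y =>
      if c == madd x y then W x y z else 0))))).
  apply: eq_bsum => c cN; apply: eq_bsum => z _; rewrite (smul_coef _ _ cN) /W.
  have [xc|xc] := eqP; last first.
    symmetry; apply: bsum0 => y _; apply: bsum0 => x _; case: ifP => // /eqP ec.
    by rewrite -ec; case: eqP.
  rewrite mulr_bsumr mulr_bsuml; apply: eq_bsum => x _; rewrite mulr_bsumr mulr_bsuml.
  apply: eq_bsum => y _; rewrite [c == _]eq_sym.
  have [ec|_] := eqP; last by rewrite mulr0 mul0r.
  by rewrite ec xc eqxx; ring.
rewrite exchange_bsum.
under eq_bsum => z _ do rewrite exchange_bsum.
rewrite exchange_bsum; apply: eq_bsum => x _.
under eq_bsum => z _ do rewrite exchange_bsum.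
rewrite exchange_bsum; apply: eq_bsum => y _.
apply: eq_bsum => z _.
rewrite bsum_delta; case: ifPn => // yzN; rewrite /W; case: eqP => // e.
by case/negP: yzN; move: kN; rewrite -e => /inboxDl.
Qed.

Fact sone_neq0 : (sone : R) != 0.
Proof.
apply/eqP => /(congr1 (fun f : R => f (mon0 T))) /eqP.
by rewrite /sone /sconst eqxx oner_eq0.
Qed.

HB.instance Definition _ :=
  GRing.Zmodule_isNzRing.Build R smulA smul1f smulf1 smulDl smulDr sone_neq0.

Fact sscaleA (a b : CC) f : sscale a (sscale b f) = sscale (a * b) f.
Proof. by apply: serP => k; apply: mulrA. Qed.
Fact sscale1 : left_id 1 (@sscale T).
Proof. by move=> f; apply: serP => k; apply: mul1r. Qed.
Fact sscaleDr : right_distributive (@sscale T) (@sadd T).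
Proof. by move=> a f g; apply: serP => k; apply: mulrDr. Qed.
Fact sscaleDl f : {morph (@sscale T)^~ f : a b / a + b >-> sadd a b}.
Proof. by move=> a b; apply: serP => k; apply: mulrDl. Qed.

HB.instance Definition _ := GRing.Zmodule_isLmodule.Build CC R sscaleA sscale1 sscaleDr sscaleDl.

Fact sscaleAl (a : CC) f g : sscale a (smul par f g) = smul par (sscale a f) g.
Proof.
apply: serP => k; rewrite /smul /sscale mulr_sumr; apply: eq_bigr => d _ /=.
by rewrite !mulrA [a * _]mulrC.
Qed.
Fact sscaleAr (a : CC) f g : sscale a (smul par f g) = smul par f (sscale a g).
Proof.
apply: serP => k; rewrite /smul /sscale mulr_sumr; apply: eq_bigr => d _ /=.
by rewrite mulrCA.
Qed.

HB.instance Definition _ := GRing.Lmodule_isLalgebra.Build CC R sscaleAl.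
HB.instance Definition _ := GRing.Lalgebra_isAlgebra.Build CC R sscaleAr.

End SeriesRing.

(** * Degree filtration, parity and validity *)

Section SeriesTheory.
Variables (T : finType) (par : T -> bool).
Notation R := (sring par).
Implicit Types (f g h : R) (a b e k : mon T) (v : T) (N : nat).

Definition xmon e : R := fun k => if k == e then 1 else 0.

Lemma ser_coef_sum I (r : seq I) (P : pred I) (F : I -> R) k :
  (\sum_(i <- r | P i) F i) k = \sum_(i <- r | P i) F i k.
Proof. exact: (big_morph (fun f : R => f k)). Qed.

Lemma ser_coef_bsum N (F : mon T -> R) k : (bsum N F) k = bsum N (fun a => F a k).
Proof. exact: ser_coef_sum. Qed.

Lemma xmon0 : xmon (mon0 T) = 1. Proof. by []. Qed.

Lemma xmon_delta v : xmon (mdelta v) = svar v. Proof. by []. Qed.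

Lemma xmonM a b : xmon a * xmon b = msign par a b *: xmon (madd a b).
Proof.
apply: serP => k; rewrite [LHS](smul_coef _ _ (inbox_mbnd k)).
transitivity (bsum (mbnd k) (fun x => if x == a then
    if inbox (mbnd k) b then (if madd x b == k then msign par x b else 0) else 0 else 0)).
  apply: eq_bsum => x _; rewrite /xmon; case: eqP => [->|_]; last first.
    by apply: bsum0 => y _; rewrite mulr0 mul0r; case: ifP.
  rewrite -(bsum_delta _ _ (fun b => if madd a b == k then msign par a b else 0)).
  apply: eq_bsum => y _; case: (y =P b) => [->|_]; first by rewrite !mulr1.
  by rewrite mulr0; case: ifP.
rewrite bsum_delta -[RHS]/(msign par a b * (if k == madd a b then 1 else 0)).
rewrite [k == _]eq_sym; case: eqP => [<-|_]; last by rewrite mulr0 !if_same.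
by rewrite mulr1 (inboxDl (inbox_mbnd _)) maddC (inboxDl (inbox_mbnd _)).
Qed.

(** The filtration by total degree. It provides the topology: continuity is preservation of each
    step, and by [vanish_eq] equality may be tested modulo every step. *)
Definition vanish N f := forall k, (mdeg k < N)%N -> f k = 0.

Lemma vanishD N f g : vanish N f -> vanish N g -> vanish N (f + g).
Proof. by move=> f0 g0 k kN; rewrite -[LHS]/(f k + g k) f0 // g0 // addr0. Qed.

Lemma vanishN N f : vanish N f -> vanish N (- f).
Proof. by move=> f0 k kN; rewrite -[LHS]/(- f k) f0 // oppr0. Qed.

Lemma vanishB N f g : vanish N f -> vanish N g -> vanish N (f - g).
Proof. by move=> f0 g0; apply/vanishD/vanishN. Qed.

Lemma vanishZ N (c : CC) f : vanish N f -> vanish N (c *: f).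
Proof. by move=> f0 k kN; rewrite -[LHS]/(c * f k) f0 // mulr0. Qed.

Lemma vanish_sum N I (r : seq I) (P : pred I) (F : I -> R) :
  (forall i, P i -> vanish N (F i)) -> vanish N (\sum_(i <- r | P i) F i).
Proof. by move=> F0 k kN; rewrite ser_coef_sum big1 // => i /F0->. Qed.

Lemma vanishM N M f g : vanish N f -> vanish M g -> vanish (N + M) (f * g).
Proof.
move=> f0 g0 k kNM; rewrite [LHS](smul_coef _ _ (inbox_mbnd k)).
apply: bsum0 => a _; apply: bsum0 => b _; case: (madd a b =P k) => // ab; move: kNM; rewrite -ab mdegD.
case: (ltnP (mdeg a) N) => [/f0-> _|aN]; first by rewrite mulr0 mul0r.
case: (ltnP (mdeg b) M) => [/g0-> _|bM]; first by rewrite mulr0.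
by rewrite ltnNge leq_add.
Qed.

Lemma vanishMr N f g : vanish N f -> vanish N (f * g).
Proof. by move=> f0; rewrite -[N]addn0; apply: vanishM. Qed.

Lemma vanishMl N f g : vanish N g -> vanish N (f * g).
Proof. by move=> g0; rewrite -[N]add0n; apply: vanishM. Qed.

Lemma vanishX N f n : vanish N f -> vanish (n * N) (f ^+ n).
Proof. by move=> f0; elim: n => // n IHn; rewrite exprS mulSn; apply: vanishM. Qed.

Lemma vanish_eq f g : (forall N, vanish N (f - g)) -> f = g.
Proof. by move=> fg; apply: serP => k; apply/eqP; rewrite -subr_eq0; apply/eqP/(fg (mdeg k).+1). Qed.

Lemma vanish1P f : vanish 1 f <-> f (mon0 T) = 0.
Proof. by split=> [->|f0 k]; rewrite ?mdeg0 // ltnS leqn0 => /eqP/mdeg_eq0->. Qed.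

(** Each exponent is cut at [N], not the total degree. All monomials of degree at most [N] survive,
    whence the order [N.+1] in [vanish_trunc]. *)
Definition trunc N f : R := bsum N (fun e => f e *: xmon e).

Lemma vanish_trunc N f : vanish N.+1 (f - trunc N f).
Proof.
move=> k kN; rewrite -[LHS]/(f k - trunc N f k) /trunc ser_coef_bsum.
transitivity (f k - bsum N (fun e => if e == k then f e else 0)).
  congr (_ - _); apply: eq_bsum => e _; rewrite -[LHS]/(f e * (if k == e then 1 else 0)).
  by rewrite eq_sym; case: ifP; rewrite ?mulr1 ?mulr0.
by rewrite bsum_delta inbox_mdeg // subrr.
Qed.

Lemma shomogP p f k : shomog par p f -> mpar par k != p -> f k = 0.
Proof. by move=> fp; case: (eqVneq (f k) 0) => // /fp->; rewrite eqxx. Qed.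

Lemma shomog0 p : shomog par p (0 : R).
Proof. by move=> k /eqP. Qed.

Lemma shomogD p f g : shomog par p f -> shomog par p g -> shomog par p (f + g).
Proof.
move=> fp gp k fg0; apply/eqP; apply: contraNT fg0 => kp.
by rewrite -[f + g]/(sadd f g) /sadd (shomogP fp kp) (shomogP gp kp) addr0.
Qed.

Lemma shomogZ p (c : CC) f : shomog par p f -> shomog par p (c *: f).
Proof.
move=> fp k fg0; apply/eqP; apply: contraNT fg0 => kp.
by rewrite -[c *: f]/(sscale c f) /sscale (shomogP fp kp) mulr0.
Qed.

Lemma shomogN p f : shomog par p f -> shomog par p (- f).
Proof. by rewrite -scaleN1r; apply: shomogZ. Qed.

Lemma shomog_sum p I (r : seq I) (P : pred I) (F : I -> R) :
  (forall i, P i -> shomog par p (F i)) -> shomog par p (\sum_(i <- r | P i) F i).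
Proof.
move=> Fp; elim/big_rec: _ => [|i f Pi fp]; first exact: shomog0.
exact: shomogD (Fp i Pi) fp.
Qed.

Lemma shomog1 : shomog par false (1 : R).
Proof.
move=> k; rewrite -[1]/(sconst 1) /sconst; case: (k =P mon0 T) => [->|_]; last by rewrite eqxx.
by rewrite mpar0.
Qed.

Lemma shomogM p q f g : shomog par p f -> shomog par q g -> shomog par (p (+) q) (f * g).
Proof.
move=> fp gq k fg0; apply/eqP; apply: contraNT fg0 => kpq; apply/eqP.
rewrite [LHS](smul_coef _ _ (inbox_mbnd k)); apply: bsum0 => a _; apply: bsum0 => b _.
case: (madd a b =P k) => // ab; move: kpq; rewrite -ab mparD.
case: (eqVneq (mpar par a) p) => [->|/(shomogP fp)->]; last by rewrite mulr0 mul0r.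
case: (eqVneq (mpar par b) q) => [->|/(shomogP gq)->]; last by rewrite mulr0.
by rewrite eqxx.
Qed.

Lemma shomogX p f n : shomog par p f -> shomog par (odd n && p) (f ^+ n).
Proof.
move=> fp; elim: n => [|n IHn]; first exact: shomog1.
have -> : odd n.+1 && p = p (+) (odd n && p) by rewrite /=; case: (p); case: (odd n).
by rewrite exprS; apply: shomogM.
Qed.

Lemma shomog_svar v : shomog par (par v) (svar v : R).
Proof.
move=> k; rewrite /svar; case: (k =P mdelta v) => [->|_]; last by rewrite eqxx.
by rewrite mpar_delta.
Qed.

Lemma supercomm p q f g : shomog par p f -> shomog par q g ->
  f * g = (-1) ^+ (p && q) *: (g * f).
Proof.
move=> fp gq; apply: serP => k.
rewrite [LHS](smul_coef _ _ (inbox_mbnd k)) -[RHS]/((-1) ^+ _ * smul par g f k).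
rewrite (smul_coef _ _ (inbox_mbnd k)) exchange_bsum mulr_bsumr.
apply: eq_bsum => b _; rewrite mulr_bsumr; apply: eq_bsum => a _.
rewrite [madd b a]maddC; case: eqP => // _; last by rewrite mulr0.
case: (eqVneq (mpar par a) p) => [<-|/(shomogP fp)->]; last by rewrite !(mul0r,mulr0).
case: (eqVneq (mpar par b) q) => [<-|/(shomogP gq)->]; last by rewrite !(mul0r,mulr0).
by rewrite [msign par a b]msignC; ring.
Qed.

(** Supercommutativity gives 2 f^2 = 0, and 2 is invertible in [CC]. *)
Lemma odd_sqr0 f : shomog par true f -> f * f = 0.
Proof.
move=> f1; have /eqP := supercomm f1 f1.
rewrite scaleN1r -subr_eq0 opprK -mulr2n -scaler_nat scaler_eq0 pnatr_eq0 /=.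
by move/eqP.
Qed.

Lemma svalid0 : svalid par (0 : R). Proof. by []. Qed.

Lemma svalidD f g : svalid par f -> svalid par g -> svalid par (f + g).
Proof. by move=> fv gv e v pv ev; rewrite -[LHS]/(f e + g e) (fv e v) // (gv e v) // addr0. Qed.

Lemma svalidZ (c : CC) f : svalid par f -> svalid par (c *: f).
Proof. by move=> fv e v pv ev; rewrite -[LHS]/(c * f e) (fv e v) // mulr0. Qed.

Lemma svalidN f : svalid par f -> svalid par (- f).
Proof. by rewrite -scaleN1r; apply: svalidZ. Qed.

Lemma svalid_sum I (r : seq I) (P : pred I) (F : I -> R) :
  (forall i, P i -> svalid par (F i)) -> svalid par (\sum_(i <- r | P i) F i).
Proof. by move=> Fv e v pv ev; rewrite ser_coef_sum big1 // => i /Fv/(_ e v pv ev). Qed.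

Lemma svalid1 : svalid par (1 : R).
Proof.
move=> e v _; rewrite -[1]/(sconst 1) /sconst; case: (e =P mon0 T) => // ->.
by rewrite ffunE.
Qed.

(** If [v] has exponent at most 1 in each factor and at least 2 in the product, it occurs in both
    factors, and then [msign] is zero. *)
Lemma svalidM f g : svalid par f -> svalid par g -> svalid par (f * g).
Proof.
move=> fv gv k v pv kv; rewrite [LHS](smul_coef _ _ (inbox_mbnd k)).
apply: bsum0 => a _; apply: bsum0 => b _; case: eqP => // ab.
case: (ltnP 1 (a v)) => [/(fv _ _ pv)->|a1]; first by rewrite mulr0 mul0r.
case: (ltnP 1 (b v)) => [/(gv _ _ pv)->|b1]; first by rewrite mulr0.
rewrite msignE ifT ?mul0r //; apply/existsP; exists v; rewrite pv /=.
by move: kv a1 b1; rewrite -ab ffunE; case: (a v) (b v) => [|[|?]] [|[|?]].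
Qed.

Lemma svalidX f n : svalid par f -> svalid par (f ^+ n).
Proof.
move=> fv; elim: n => [|n IHn]; first exact: svalid1.
by rewrite exprS; apply: svalidM.
Qed.

Lemma svalid_svar v : svalid par (svar v : R).
Proof.
move=> e w _; rewrite /svar; case: eqP => // ->; rewrite ffunE.
by case: (w == v).
Qed.

End SeriesTheory.
Arguments vanish_trunc {T par} N f.

(** * Continuous semilinear morphisms *)

(** [sm_vanish] is continuity for the degree filtration. The scalar map [cj] will be the identity or
    the conjugation, so that one theory serves S, Delta and the antilinear sigma. Evenness is
    recovered from the images of the generators in [sm_shomog]. *)
Record smorph (cj : CC -> CC) (T U : finType) (parT : T -> bool) (parU : U -> bool) :=
  SMorph {
    sm_fun :> sring parT -> sring parU;
    smB : {morph sm_fun : f g / f - g};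
    sm1 : sm_fun 1 = 1;
    smM : {morph sm_fun : f g / f * g};
    smZ : forall c f, sm_fun (c *: f) = cj c *: sm_fun f;
    sm_vanish : forall N f, vanish N f -> vanish N (sm_fun f) }.

HB.instance Definition _ cj (T U : finType) (parT : T -> bool) (parU : U -> bool)
    (s : smorph cj parT parU) :=
  GRing.isZmodMorphism.Build _ _ (sm_fun s) (@smB _ _ _ _ _ s).
HB.instance Definition _ cj (T U : finType) (parT : T -> bool) (parU : U -> bool)
    (s : smorph cj parT parU) :=
  GRing.isMonoidMorphism.Build _ _ (sm_fun s) (sm1 s, @smM _ _ _ _ _ s).

Section Comp.
Variables (cj1 cj2 : CC -> CC) (T U W : finType).
Variables (parT : T -> bool) (parU : U -> bool) (parW : W -> bool).
Variables (s1 : smorph cj1 parU parW) (s2 : smorph cj2 parT parU).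

Definition sm_comp : smorph (cj1 \o cj2) parT parW.
Proof.
exists (s1 \o s2) => [f g||f g|c f|N f f0] /=; rewrite ?rmorphB ?rmorph1 ?rmorphM ?smZ //.
by do 2!apply: sm_vanish.
Defined.

End Comp.

Section Density.
Variables (cj : CC -> CC) (T U : finType) (parT : T -> bool) (parU : U -> bool).

(** By f g - f' g' = (f - f') g + f' (g - g'), both factors may be replaced by their truncations up
    to terms of high degree. Truncations are finite combinations of monomials, where bilinearity
    applies. *)
Lemma dense_morphM (phi : {additive sring parT -> sring parU}) :
    (forall c f, phi (c *: f) = cj c *: phi f) ->
    (forall N f, vanish N f -> vanish N (phi f)) ->
    (forall a b, phi (xmon parT a * xmon parT b) = phi (xmon parT a) * phi (xmon parT b)) ->
  {morph phi : f g / f * g}.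
Proof.
move=> phiZ phiv phiX f g; apply: vanish_eq => N.
have vanishW h : vanish N.+1 h -> vanish N h by move=> h0 k kN; apply/h0/ltnW.
apply: vanishW.
have /phiv := vanishD (vanishMr g (vanish_trunc N f))
                      (vanishMl (trunc N f) (vanish_trunc N g)).
have := vanishD (vanishMr (phi g) (phiv _ _ (vanish_trunc N f)))
                (vanishMl (phi (trunc N f)) (phiv _ _ (vanish_trunc N g))).
set tf := trunc N f; set tg := trunc N g.
have -> : (f - tf) * g + tf * (g - tg) = f * g - tf * tg.
  by rewrite mulrBl mulrBr addrA subrK.
have -> : phi (f - tf) * phi g + phi tf * phi (g - tg) = phi f * phi g - phi tf * phi tg.
  by rewrite !raddfB mulrBl mulrBr addrA subrK.
have -> : phi (f * g - tf * tg) = phi (f * g) - phi tf * phi tg.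
  rewrite raddfB; congr (_ - _); rewrite /tf /tg /trunc /bsum mulr_suml !raddf_sum mulr_suml.
  apply: eq_bigr => a _; rewrite mulr_sumr raddf_sum mulr_sumr; apply: eq_bigr => b _.
  by rewrite -scalerAl -scalerAr !phiZ phiX -scalerAl -scalerAr.
move=> v1 v2; have := vanishB v2 v1.
by rewrite opprB addrA subrK.
Qed.

Definition mvalid (e : mon T) := forall v, parT v -> (e v <= 1)%N.

Lemma dense_eq (phi psi : {additive sring parT -> sring parU}) :
    (forall c f, phi (c *: f) = cj c *: phi f) ->
    (forall c f, psi (c *: f) = cj c *: psi f) ->
    (forall N f, vanish N f -> vanish N (phi f)) ->
    (forall N f, vanish N f -> vanish N (psi f)) ->
    (forall e, mvalid e -> phi (xmon parT e) = psi (xmon parT e)) ->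
  forall f : sring parT, svalid parT f -> phi f = psi f.
Proof.
move=> phiZ psiZ phiv psiv ee f fv; apply: vanish_eq => N.
have vanishW h : vanish N.+1 h -> vanish N h by move=> h0 k kN; apply/h0/ltnW.
apply: vanishW.
have := vanishB (phiv _ _ (vanish_trunc N f))
  (psiv _ _ (vanish_trunc N f)).
have e0 : phi (trunc N f) = psi (trunc N f).
  rewrite /trunc /bsum !raddf_sum; apply: eq_bigr => d _; rewrite phiZ psiZ.
  have [/ee->//|] := EM (mvalid (box_mon d)).
  rewrite /mvalid => /existsNP[v] /not_implyP[pv /negP]; rewrite -ltnNge => dv.
  have -> : f (box_mon d) = 0 by apply: fv dv.
  (* [cj] is a bare function here: that [cj 0] kills the image is read off from the image of
     [0 *: x]. *)
  have Z0 (ch : {additive sring parT -> sring parU}) :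
     (forall c f, ch (c *: f) = cj c *: ch f) -> forall x, cj 0 *: ch x = 0.
    by move=> chZ x; rewrite -chZ scale0r raddf0.
  by rewrite !Z0.
by rewrite (raddfB phi) (raddfB psi) e0 opprB addrA subrK.
Qed.

End Density.

(** By density only valid monomials matter, and these are, up to sign, products of generators. Two
    scalar maps are allowed because a composite of two antilinear maps carries
    [Num.conj \o Num.conj], which is compared with the identity pointwise. *)
Lemma sm_eq cj cj' (T U : finType) (parT : T -> bool) (parU : U -> bool)
    (s : smorph cj parT parU) (t : smorph cj' parT parU) : cj =1 cj' ->
  (forall v, s (svar v) = t (svar v)) -> forall f : sring parT, svalid parT f -> s f = t f.
Proof.
move=> cjE st; have tZ c f : t (c *: f) = cj c *: t f by rewrite cjE smZ.
apply: dense_eq; [exact: smZ|exact: tZ|exact: sm_vanish|exact: sm_vanish|].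
move=> e; rewrite -[_ -> _]/(mvalid parT e -> s (xmon parT e) = t (xmon parT e)).
have [n] := ubnP (mdeg e); elim: n e => // n IHn e en ev.
have [e0|/existsNP[v /eqP]] := EM (forall v, e v = 0%N).
  have -> : e = mon0 T by apply/ffunP => v; rewrite e0 ffunE.
  by rewrite xmon0 !sm1.
(* a nonconstant valid monomial is, up to a sign, a generator times a smaller valid monomial *)
rewrite -lt0n => ev0; pose e' : mon T := [ffun w => (e w - (w == v))%N].
have ee : e = madd (mdelta v) e'.
  apply/ffunP => w; rewrite !ffunE subnKC //; by case: eqP => // ->.
have e'n : (mdeg e' < n)%N by move: en; rewrite ee mdegD mdeg_delta.
have e'v : mvalid parT e'.
  by move=> w /ev; rewrite ffunE; apply: leq_trans; apply: leq_subr.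
have m0 : ~~ mover parT (mdelta v) e'.
  apply/existsP => -[w /and3P[pw]]; rewrite !ffunE lt0b => /eqP wv; move: pw; rewrite wv => pv.
  by rewrite eqxx subn_gt0 ltnNge => /negP[]; apply: ev.
have xe : xmon parT e = (-1) ^+ mexp parT (mdelta v) e' *: ((svar v : sring parT) * xmon parT e').
  rewrite -xmon_delta xmonM msignE (negPf m0) scalerA -ee.
  by rewrite -expr2 sqrr_sign scale1r.
by rewrite xe smZ tZ !smM IHn //= st.
Qed.

Lemma enum_rank_index (T : finType) (v : T) : enum_rank v = index v (enum T) :> nat.
Proof. by rewrite -{2}(nth_enum_rank v v) index_uniq ?enum_uniq // -cardE. Qed.

(** * Powers, products and sums of the definitions as ring operations *)

Section ProductBridge.
Variables (T : finType) (par : T -> bool).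

Lemma spowE (f : sring par) n : spow par f n = f ^+ n :> sring par.
Proof. by elim: n => // n IHn; rewrite exprS -IHn. Qed.

Lemma sprodlE I (s : seq I) (F : I -> sring par) :
  sprodl par [seq F i | i <- s] = \prod_(i <- s) F i :> sring par.
Proof. by elim: s => [|i s IHs] /=; rewrite ?big_nil // big_cons -IHs. Qed.

Lemma ssumE (I : finType) (F : I -> sring par) : ssum F = \sum_i F i :> sring par.
Proof. by apply: serP => k; rewrite ser_coef_sum. Qed.

End ProductBridge.

(** * Substitution *)

Section Substitution.
Variables (T U : finType) (parT : T -> bool) (parU : U -> bool).
Variable h : T -> sring parU.
Implicit Types (a b e : mon T) (s : seq T).

Definition hprod s e : sring parU := \prod_(v <- s) h v ^+ e v.
Definition hmon := hprod (enum T).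

Lemma subst_genE cj f k :
  subst_gen parU cj f h k = bsum (mdeg k) (fun e => cj (f e) * hmon e k).
Proof.
apply: eq_bigr => d _; rewrite /hmon /hprod -sprodlE.
by congr (_ * sprodl _ _ _); apply: eq_map => v; rewrite spowE.
Qed.

Lemma subst_gen_valid cj f : (forall v, svalid parU (h v)) -> svalid parU (subst_gen parU cj f h).
Proof.
move=> hv k w pw kw; rewrite subst_genE; apply: bsum0 => e _.
suff -> : hmon e k = 0 by rewrite mulr0.
have : svalid parU (hmon e).
  rewrite /hmon /hprod; elim/big_rec: _ => [|v f' _ f'v]; first exact: svalid1.
  by apply: svalidM => //; apply: svalidX; apply: hv.
by move/(_ _ _ pw kw).
Qed.

Hypothesis hpar : forall v, shomog parU (parT v) (h v).

Lemma shomog_hprod s e :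
  shomog parU (odd (\sum_(v <- s | parT v) e v)%N) (hprod s e).
Proof.
rewrite /hprod; elim: s => [|v s IHs]; first by rewrite !big_nil; apply: shomog1.
have := shomogM (shomogX (n := e v) (@hpar v)) IHs.
by rewrite !big_cons; case: (parT v); rewrite ?andbT ?oddD ?andbF.
Qed.

Lemma hprod_over s e v : v \in s -> parT v -> (1 < e v)%N -> hprod s e = 0.
Proof.
move=> vs pv ev; rewrite /hprod; case/splitPr: vs => s1 s2.
rewrite big_cat big_cons /=; have := @hpar v; rewrite pv => /odd_sqr0 h2.
case: (e v) ev => [|[|n]] // _.
by rewrite (_ : h v ^+ n.+2 = 0) ?mul0r ?mulr0 // 2!exprS mulrA h2 mul0r.
Qed.

(* Number of exchanges of odd factors needed to merge x^a x^b into x^(a+b). *)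
Fixpoint swaps s a b : nat := match s with
  | [::] => 0%N
  | v :: s' => ((if parT v then \sum_(w <- s' | parT w) a w * b v else 0) + swaps s' a b)%N
  end.

(** With the head [v] split off, the factor h v ^ b v has to cross the product of the h w ^ a w over
    the tail; supercommutativity of these two homogeneous elements gives the new sign. *)
Lemma hprodM s a b : hprod s a * hprod s b = (-1) ^+ swaps s a b *: hprod s (madd a b).
Proof.
rewrite /hprod; elim: s => [|v s IHs]; first by rewrite !big_nil mulr1 scale1r.
rewrite !big_cons /= exprD ffunE exprD.
set x := h v ^+ a v; set y := h v ^+ b v.
set P := \big[_/_]_(w <- s) h w ^+ a w; set Q := \big[_/_]_(w <- s) h w ^+ b w in IHs *.
have -> : x * P * (y * Q) = x * (P * y) * Q by rewrite !mulrA.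
rewrite (supercomm (@shomog_hprod s a) (shomogX (n := b v) (@hpar v))) -/P -/y.
rewrite -scalerAr -scalerAl (_ : x * (y * P) * Q = x * y * (P * Q)) ?mulrA //.
rewrite -mulrA IHs -scalerAr scalerA.
congr (_ * _ *: _); case: (parT v); last by rewrite !andbF.
by rewrite andbT -oddM signr_odd big_distrl.
Qed.

(** Identifies the recursive count with the inversion count of [mexp], where the position in the
    list plays the role of [enum_rank]. *)
Lemma swapsE s a b : uniq s -> swaps s a b =
  (\sum_(v <- s | parT v) \sum_(w <- s | parT w && (index w s < index v s)%N) a v * b w)%N.
Proof.
elim: s => [|x s IHs] /=; first by rewrite big_nil.
move=> /andP[xs us]; rewrite IHs // big_cons.
rewrite [X in if _ then (X + _)%N else _]big1 ?add0n ?if_same; last first.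
  by move=> w /=; rewrite eqxx ltn0 andbF.
have -> : (if parT x then \sum_(w <- s | parT w) a w * b x else 0)%N =
          (\sum_(v <- s | parT v) (if parT x then a v * b x else 0))%N.
  by case: (parT x); rewrite ?big1_eq.
rewrite -big_split big_seq_cond [RHS]big_seq_cond; apply: eq_bigr => v /andP[vs pv].
rewrite big_cons /=; have xv : (x == v) = false by apply: contraNF xs => /eqP->.
rewrite eqxx xv /= andbT.
have -> : (\sum_(j <- s | parT j && ((if x == j then 0 else (index j s).+1) < (index v s).+1))
     a v * b j = \sum_(w <- s | parT w && (index w s < index v s)) a v * b w)%N.
  rewrite big_seq_cond [RHS]big_seq_cond; apply: eq_bigl => w.
  have [ws|] //= := boolP (w \in s).
  by have -> : (x == w) = false by apply: contraNF xs => /eqP->.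
by case: (parT x).
Qed.

(** The images of monomials multiply with the structure constants of [xmonM]. This is the algebraic
    reason why substitution is a morphism. *)
Lemma hmonM a b : hmon a * hmon b = msign parT a b *: hmon (madd a b).
Proof.
rewrite [LHS]hprodM msignE; case: ifPn => [/existsP[v /and3P[pv av bv]]|_].
  have -> : hprod (enum T) (madd a b) = 0.
    apply: (hprod_over (v := v)); rewrite ?mem_enum // ffunE.
    by rewrite -addn1 leq_add.
  by rewrite scaler0 scale0r.
congr (_ ^+ _ *: _); rewrite swapsE ?enum_uniq // big_enum_cond /=.
apply: eq_bigr => v _; rewrite big_enum_cond; apply: eq_bigl => w.
by rewrite !enum_rank_index.
Qed.

Hypothesis h0 : forall v, h v (mon0 U) = 0.

(** Without constant terms in [h], the image of x^e starts in degree [mdeg e]. Only exponents of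
    degree at most [mdeg k] reach the coefficient at [k], and the box of [subst_gen] contains them
    all. *)
Lemma vanish_hmon e : vanish (mdeg e) (hmon e).
Proof.
rewrite /hmon /hprod /mdeg -big_enum /=; elim: (enum T) => [|v s IHs].
  by rewrite !big_nil.
rewrite !big_cons; apply: vanishM IHs; have /vanishX := (vanish1P (h v)).2 (h0 v).
by move/(_ (e v)); rewrite muln1.
Qed.

Variable cj : {rmorphism CC -> CC}.
Let Phi : sring parT -> sring parU := fun f => subst_gen parU cj f h.

Let PhiB : zmod_morphism Phi.
Proof.
move=> f g; apply: serP => k; rewrite -[RHS]/(Phi f k - Phi g k) /Phi !subst_genE.
rewrite /bsum -sumrB; apply: eq_bigr => d _.
by rewrite -[(f - g) _]/(f (box_mon d) - g (box_mon d)) rmorphB mulrBl.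
Qed.

Let PhiZ c f : Phi (c *: f) = cj c *: Phi f.
Proof.
apply: serP => k; rewrite -[RHS]/(cj c * Phi f k) /Phi !subst_genE mulr_bsumr.
by apply: eq_bsum => e _; rewrite -[(c *: f) _]/(c * f e) rmorphM mulrA.
Qed.

Let Phi_vanish N f : vanish N f -> vanish N (Phi f).
Proof.
move=> f0 k kN; rewrite /Phi subst_genE; apply: bsum0 => e _.
have [ek|ke] := leqP (mdeg e) (mdeg k); last by rewrite vanish_hmon ?mulr0.
by rewrite f0 ?rmorph0 ?mul0r //; apply: leq_ltn_trans kN.
Qed.

Let Phi_xmon e : Phi (xmon parT e) = hmon e.
Proof.
apply: serP => k; rewrite /Phi subst_genE.
transitivity (bsum (mdeg k) (fun e' => if e' == e then hmon e' k else 0)).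
  apply: eq_bsum => e' _; rewrite /xmon; case: eqP => _; rewrite ?rmorph1 ?mul1r //.
  by rewrite rmorph0 mul0r.
rewrite bsum_delta; case: ifPn => // ek; symmetry; apply: vanish_hmon.
by rewrite ltnNge; apply: contra ek => /inbox_mdeg.
Qed.

HB.instance Definition _ := GRing.isZmodMorphism.Build _ _ Phi PhiB.

Definition sm_subst : smorph cj parT parU.
Proof.
exists Phi.
- exact: PhiB.
- by rewrite -(xmon0 parT) Phi_xmon /hmon /hprod big1 // => v _; rewrite ffunE.
- apply: (dense_morphM PhiZ Phi_vanish) => a b.
  rewrite -[LHS]/(Phi (xmon parT a * xmon parT b)) -[RHS]/(Phi (xmon parT a) * Phi (xmon parT b)).
  (* The ring morphism [cj] fixes [msign], whose values are 0 and signs. *)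
  by rewrite xmonM PhiZ !Phi_xmon hmonM msignE; case: ifP => _; rewrite ?rmorph0 // rmorphXn rmorphN1.
- exact: PhiZ.
- exact: Phi_vanish.
Defined.

Lemma sm_subst_svar v : sm_subst (svar v) = h v.
Proof.
rewrite -[LHS]/(Phi (xmon parT (mdelta v))) Phi_xmon /hmon /hprod.
have := mem_enum T v; have := enum_uniq T; elim: (enum T) => //= w s IHs /andP[ws us].
rewrite big_cons ffunE inE; have [vw _|vw /=] := eqVneq v w; last first.
  by rewrite mul1r; apply: IHs.
rewrite vw expr1 big_seq big1 ?mulr1 // => u us'; rewrite ffunE.
by have -> : (u == w) = false by apply: contraNF ws => /eqP<-.
Qed.

End Substitution.

(** * Antimorphisms are morphisms *)

Section Antisubst.
Variables (T U : finType) (parT : T -> bool) (parU : U -> bool).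
Variable h : T -> sring parU.
Hypothesis hpar : forall v, shomog parU (parT v) (h v).

(** Reversing o odd factors takes C(o, 2) exchanges. An odd head occurring once crosses o others, in
    accordance with C(1 + o, 2) = C(o, 2) + o; occurring twice or more, it makes both sides zero. *)
Lemma hprod_rev s (e : mon T) :
  hprod h (rev s) e = (-1) ^+ 'C(\sum_(v <- s | parT v) e v, 2) *: hprod h s e.
Proof.
rewrite /hprod; elim: s => [|v s IHs]; first by rewrite !big_nil scale1r.
rewrite rev_cons -cats1 big_cat big_seq1 IHs !big_cons /= -scalerAl.
rewrite (supercomm (@shomog_hprod _ _ _ _ _ hpar s e) (shomogX (n := e v) (@hpar v))).
have := @hpar v; case: (parT v) => hv; last by rewrite !andbF scale1r.
rewrite andbT; set o := (\sum_(v <- s | parT v) e v)%N.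
case: (e v) => [|[|n]].
- by rewrite andbF scale1r add0n.
- by rewrite andbT add1n binS bin1 exprD signr_odd scalerA mulrC.
- by rewrite 2!exprS mulrA (odd_sqr0 hv) !mul0r !scaler0.
Qed.

(** The sign in the definition of the antimorphism and the sign from reversing the product are the
    same, so they cancel. The antipode thereby falls under the theory of morphisms. *)
Lemma antisubstE f : antisubst parU parT f h = subst parU f h.
Proof.
apply: (@serP _ parU) => k; apply: eq_bigr => d _ /=.
rewrite -mulrA; congr (@GRing.mul CC _ _).
have spE s : sprodl parU [seq spow parU (h v) ([ffun v0 => nat_of_ord (d v0)] v) | v <- s] =
    hprod h s (box_mon d).
  by rewrite /hprod -sprodlE; congr sprodl; apply: eq_map => v; rewrite spowE.
rewrite !spE hprod_rev big_enum_cond /=.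
pose c : CC := (-1) ^+ 'C(\sum_(v | parT v) box_mon d v, 2).
by rewrite -[LHS]/(c * (c * hprod h (enum T) (box_mon d) k)) mulrA -expr2 sqrr_sign mul1r.
Qed.
End Antisubst.

(** * The parity involution *)

Section ParityInvolution.
Variables (T : finType) (par : T -> bool).
Notation R := (sring par).
Implicit Types f g : R.

Let sgn (f : R) : R := fun e => (-1) ^+ mpar par e * f e.

Let sgnB : zmod_morphism sgn.
Proof. by move=> f g; apply: serP => k; apply: mulrBr. Qed.
Let sgnZ (c : CC) f : sgn (c *: f) = c *: sgn f.
Proof. by apply: serP => k; apply: mulrCA. Qed.
Let sgn_vanish N f : vanish N f -> vanish N (sgn f).
Proof. by move=> f0 k kN; rewrite /sgn f0 // mulr0. Qed.
Let sgn_xmon e : sgn (xmon par e) = (-1) ^+ mpar par e *: xmon par e.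
Proof.
apply: serP => k; rewrite /sgn -[RHS]/((-1) ^+ _ * xmon par e k) /xmon.
by case: eqP => [->//|]; rewrite !mulr0.
Qed.

HB.instance Definition _ := GRing.isZmodMorphism.Build _ _ sgn sgnB.

(** A morphism that multiplies a homogeneous f by (-1)^|f|. By [sm_sgnP] homogeneity is an
    eigenvector equation for it, so that statements on parity become equalities of morphisms. *)
Definition sm_sgn : smorph idfun par par.
Proof.
exists sgn.
- exact: sgnB.
- by rewrite -(xmon0 par) sgn_xmon mpar0 scale1r.
- apply: (dense_morphM sgnZ sgn_vanish) => a b.
  rewrite -[LHS]/(sgn (xmon par a * xmon par b)) -[RHS]/(sgn (xmon par a) * sgn (xmon par b)).
  rewrite xmonM sgnZ !sgn_xmon -scalerAl -scalerAr xmonM mparD !scalerA; congr (_ *: _).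
  by rewrite signr_addb; ring.
- exact: sgnZ.
- exact: sgn_vanish.
Defined.

Lemma sm_sgnP p f : shomog par p f <-> sm_sgn f = (-1) ^+ p *: f.
Proof.
split=> [fp|/(congr1 (fun g : R => g _)) fp k fk].
  apply: serP => k; rewrite -[LHS]/((-1) ^+ mpar par k * f k) -[RHS]/((-1) ^+ p * f k).
  by have [->|/fp->//] := eqVneq (f k) 0; rewrite !mulr0.
have := fp k; rewrite -[LHS]/((-1) ^+ mpar par k * f k) -[RHS]/((-1) ^+ p * f k).
by move/(mulIf fk)/signr_inj.
Qed.
End ParityInvolution.

(** * Matrices of series and Neumann inverses *)

Section Neumann.
Variables (T : finType) (par : T -> bool).
Notation R := (sring par).

Lemma ssum_infE (F : nat -> R) k N : (forall t, vanish t (F t)) -> (mdeg k < N)%N ->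
  ssum_inf F k = (\sum_(t < N) F t) k.
Proof.
move=> F0 kN; rewrite ser_coef_sum /ssum_inf (big_ord_widen _ (fun t => F t k) kN) big_mkcond.
by apply: eq_bigr => t _; case: ltnP => // kt; rewrite F0.
Qed.

Lemma svalid_ssum_inf (F : nat -> R) : (forall t, svalid par (F t)) -> svalid par (ssum_inf F).
Proof. by move=> Fv e v pv ev; apply: big1 => t _; apply: Fv ev. Qed.

Lemma shomog_ssum_inf p (F : nat -> R) :
  (forall t, shomog par p (F t)) -> shomog par p (ssum_inf F).
Proof.
move=> Fp e Fe; apply/eqP; apply: contraNT Fe => ep; apply/eqP.
by apply: big1 => t _; apply: shomogP (Fp t) ep.
Qed.

Definition toM a b (M : 'I_a -> 'I_b -> ser T) : 'M[R]_(a, b) := \matrix_(i, j) (M i j : R).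

Lemma sconstE c : sconst c = c *: 1 :> R.
Proof.
apply: serP => k; rewrite -[RHS]/(c * (if k == mon0 T then 1 else 0)) /sconst.
by case: eqP; rewrite ?mulr1 ?mulr0.
Qed.

Lemma sconst_nat (i : nat) : sconst i%:R = i%:R :> R.
Proof. by rewrite sconstE scaler_nat. Qed.

Lemma toM1 p : toM (@mx1 T p) = 1%:M.
Proof. by apply/matrixP => i j; rewrite !mxE /mx1 sconst_nat. Qed.

Lemma toM_add p (M N : smx T p) : toM (mxadd M N) = toM M + toM N.
Proof. by apply/matrixP => i j; rewrite !mxE. Qed.

Lemma toM_opp p (M : smx T p) : toM (mxopp M) = - toM M.
Proof. by apply/matrixP => i j; rewrite !mxE. Qed.

Lemma toM_mul a b c (M : 'I_a -> 'I_b -> ser T) (N : 'I_b -> 'I_c -> ser T) :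
  toM (mxmul par M N) = toM M *m toM N.
Proof.
apply/matrixP => i j; rewrite !mxE /mxmul ssumE.
by apply: eq_bigr => k _; rewrite !mxE.
Qed.

Definition mpow p (E : 'M[R]_p) t := iter t (mulmx E) 1%:M.

Lemma toM_pow p (M : smx T p) t : toM (mxpow par M t) = mpow (toM M) t.
Proof. by elim: t => [|t IHt]; rewrite ?toM1 //= -IHt -toM_mul. Qed.

Lemma mpowSr p (E : 'M[R]_p) t : mpow E t.+1 = mpow E t *m E.
Proof.
elim: t => [|t IHt]; first by rewrite /= mulmx1 mul1mx.
by rewrite -[LHS]/(E *m mpow E t.+1) {1}IHt mulmxA.
Qed.

Definition mxeven a b (pr : 'I_a -> bool) (pc : 'I_b -> bool) (M : 'M[R]_(a, b)) :=
  forall i j, shomog par (pr i (+) pc j) (M i j).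
Definition mxvalid a b (M : 'M[R]_(a, b)) := forall i j, svalid par (M i j).
Definition mxvanish N a b (M : 'M[R]_(a, b)) := forall i j, vanish N (M i j).

Lemma mxeven1 p (pr : 'I_p -> bool) : mxeven pr pr 1%:M.
Proof.
move=> i j; rewrite mxE; case: eqP => [->|_]; last exact: shomog0.
by rewrite addbb; apply: shomog1.
Qed.

Lemma mxevenM a b c pr pm pc (M : 'M[R]_(a, b)) (N : 'M[R]_(b, c)) :
  mxeven pr pm M -> mxeven pm pc N -> mxeven pr pc (M *m N).
Proof.
move=> Me Ne i j; rewrite mxE; apply: shomog_sum => k _.
have -> : pr i (+) pc j = (pr i (+) pm k) (+) (pm k (+) pc j).
  by rewrite addbA -[_ (+) _ (+) pm k]addbA addbb addbF.
exact: shomogM (@Me i k) (@Ne k j).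
Qed.

Lemma mxevenD a b pr pc (M N : 'M[R]_(a, b)) :
  mxeven pr pc M -> mxeven pr pc N -> mxeven pr pc (M + N).
Proof. by move=> Me Ne i j; rewrite mxE; apply: shomogD; [apply: Me|apply: Ne]. Qed.

Lemma mxevenN a b pr pc (M : 'M[R]_(a, b)) : mxeven pr pc M -> mxeven pr pc (- M).
Proof. by move=> Me i j; rewrite mxE; apply/shomogN/Me. Qed.

Lemma mxevenB a b pr pc (M N : 'M[R]_(a, b)) :
  mxeven pr pc M -> mxeven pr pc N -> mxeven pr pc (M - N).
Proof. by move=> Me Ne; apply/mxevenD/mxevenN. Qed.

Lemma mxvalid1 p : mxvalid (1%:M : 'M[R]_p).
Proof. by move=> i j; rewrite mxE; case: eqP => _; [apply: svalid1|apply: svalid0]. Qed.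

Lemma mxvalidM a b c (M : 'M[R]_(a, b)) (N : 'M[R]_(b, c)) :
  mxvalid M -> mxvalid N -> mxvalid (M *m N).
Proof.
move=> Mv Nv i j; rewrite mxE; apply: svalid_sum => k _.
by apply: svalidM; [apply: Mv|apply: Nv].
Qed.

Lemma mxvalidB a b (M N : 'M[R]_(a, b)) : mxvalid M -> mxvalid N -> mxvalid (M - N).
Proof.
by move=> Mv Nv i j; rewrite !mxE; apply: svalidD; [apply: Mv|apply/svalidN/Nv].
Qed.

Lemma mxvanishM N K a b c (A : 'M[R]_(a, b)) (B : 'M[R]_(b, c)) :
  mxvanish N A -> mxvanish K B -> mxvanish (N + K) (A *m B).
Proof.
move=> A0 B0 i j; rewrite mxE; apply: vanish_sum => k _.
by apply: vanishM; [apply: A0|apply: B0].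
Qed.

Lemma mxvanishMr N a b c (A : 'M[R]_(a, b)) (B : 'M[R]_(b, c)) :
  mxvanish N A -> mxvanish N (A *m B).
Proof. by move=> A0; rewrite -[N]addn0; apply: mxvanishM. Qed.

Lemma mxvanishMl N a b c (A : 'M[R]_(a, b)) (B : 'M[R]_(b, c)) :
  mxvanish N B -> mxvanish N (A *m B).
Proof. by move=> B0; rewrite -[N]add0n; apply: mxvanishM. Qed.

Lemma mxvanishB N a b (A B : 'M[R]_(a, b)) :
  mxvanish N A -> mxvanish N B -> mxvanish N (A - B).
Proof. by move=> A0 B0 i j; rewrite !mxE; apply: vanishB; [apply: A0|apply: B0]. Qed.

Lemma mxvanish_eq a b (A B : 'M[R]_(a, b)) : (forall N, mxvanish N (A - B)) -> A = B.
Proof.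
move=> AB; apply/matrixP => i j; apply: vanish_eq => N.
by have := AB N i j; rewrite !mxE.
Qed.

Lemma mpow_vanish p (E : 'M[R]_p) t : mxvanish 1 E -> mxvanish t (mpow E t).
Proof. by move=> E1; elim: t => // t IHt; rewrite -add1n; apply: mxvanishM. Qed.

(** The Neumann series [mxinv] read on matrices over the ring. It is shown to be an inverse when
    [1%:M - M] has no constant terms. *)
Definition minv p (M : 'M[R]_p) : 'M[R]_p := toM (mxinv par (fun i j => M i j)).

Lemma minvE p (M : 'M[R]_p) i j :
  minv M i j = ssum_inf (fun t => mpow (1%:M - M) t i j).
Proof.
rewrite mxE /mxinv; congr ssum_inf; apply/funext => t.
have -> : 1%:M - M = toM (mxadd (@mx1 T p) (mxopp (fun i j => M i j))).
  by rewrite toM_add toM1 toM_opp; congr (_ - _); apply/matrixP => ? ?; rewrite mxE.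
by rewrite -toM_pow mxE.
Qed.

Lemma mxinvE p (M : smx T p) : toM (mxinv par M) = minv (toM M).
Proof.
by congr (toM (mxinv par _)); do 2!apply/funext=> ?; rewrite mxE.
Qed.

Lemma mxeven_inv p pr (M : 'M[R]_p) : mxeven pr pr M -> mxeven pr pr (minv M).
Proof.
move=> Me i j; rewrite minvE; apply: shomog_ssum_inf => t.
suff : mxeven pr pr (mpow (1%:M - M) t) by [].
elim: t => [|t IHt]; first exact: mxeven1.
by apply: mxevenM IHt; apply: mxevenB Me; apply: mxeven1.
Qed.

Lemma mxvalid_inv p (M : 'M[R]_p) : mxvalid M -> mxvalid (minv M).
Proof.
move=> Mv i j; rewrite minvE; apply: svalid_ssum_inf => t.
suff : mxvalid (mpow (1%:M - M) t) by [].
elim: t => [|t IHt]; first exact: mxvalid1.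
by apply: mxvalidM IHt; apply: mxvalidB Mv; apply: mxvalid1.
Qed.

Section Inverse.
Variables (p : nat) (M : 'M[R]_p).
Hypothesis M1 : mxvanish 1 (1%:M - M).
Let E := 1%:M - M.

Lemma minv_approx N : mxvanish N (minv M - \sum_(t < N) mpow E t).
Proof.
move=> i j k kN; rewrite mxE [X in _ + X]mxE minvE summxE.
set F := fun t => mpow E t i j.
have -> : \sum_(t < N) mpow E t i j = \sum_(t < N) F t by [].
rewrite -[LHS]/(ssum_inf F k - (\sum_(t < N) F t) k) (@ssum_infE F k N) ?subrr // => t.
exact: mpow_vanish.
Qed.

Let ME : M = 1%:M - E. Proof. by rewrite /E opprB addrC subrK. Qed.

(** The partial sums telescope: M times the sum of E^t over t < N is 1 - E^N, and E^N vanishes to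
    order N. *)
Lemma mulmxV_series : M *m minv M = 1%:M.
Proof.
apply: mxvanish_eq => N; have := mxvanishMl M (@minv_approx N).
rewrite mulmxBr (_ : M *m \sum_(t < N) mpow E t = 1%:M - mpow E N).
  move/mxvanishB/(_ (mpow_vanish (t := N) M1)).
  by rewrite opprB addrA addrAC addrK.
elim: (N) => [|K IHK]; first by rewrite big_ord0 mulmx0 subrr.
by rewrite big_ord_recr mulmxDr IHK {1}ME mulmxBl mul1mx addrA subrK.
Qed.

Lemma mulVmx_series : minv M *m M = 1%:M.
Proof.
apply: mxvanish_eq => N; have := mxvanishMr M (@minv_approx N).
rewrite mulmxBl (_ : (\sum_(t < N) mpow E t) *m M = 1%:M - mpow E N).
  move/mxvanishB/(_ (mpow_vanish (t := N) M1)).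
  by rewrite opprB addrA addrAC addrK.
elim: (N) => [|K IHK]; first by rewrite big_ord0 mul0mx subrr.
by rewrite big_ord_recr mulmxDl IHK {1}ME mulmxBr mulmx1 -mpowSr addrA subrK.
Qed.

Lemma minv_vanish : mxvanish 1 (1%:M - minv M).
Proof.
have := @minv_approx 1; rewrite big_ord1 /= => V1 i j k k1.
by have := V1 i j k k1; rewrite -(opprB 1%:M) [X in X k]mxE => /eqP;
  rewrite -[X in X == _]/(- _ k) oppr_eq0 => /eqP.
Qed.

Lemma minv_uniquer (N : 'M[R]_p) : M *m N = 1%:M -> N = minv M.
Proof. by move=> MN; rewrite -[LHS]mul1mx -mulVmx_series -mulmxA MN mulmx1. Qed.

End Inverse.

(** Divided by its constant term, [u] becomes a 1 x 1 matrix to which the Neumann inverse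
    applies. *)
Lemma sinvP (u : R) : u (mon0 T) != 0 -> u * (sinv par u : R) = 1 /\ (sinv par u : R) * u = 1.
Proof.
set c := u _ => c0; pose w : R := c^-1 *: u; pose M : 'M[R]_1 := w%:M.
have M1 : mxvanish 1 (1%:M - M).
  move=> i j; apply/vanish1P; rewrite !mxE !ord1 /= !mulr1n.
  by rewrite -[LHS]/((if mon0 T == mon0 T then 1 else 0) - c^-1 * c) eqxx mulVf ?subrr.
have invE : (sinv par u : R) = c^-1 *: minv M 0 0.
  rewrite minvE /sinv -/c; congr (_ *: _); congr ssum_inf; apply/funext => t.
  rewrite spowE -raddfB /=; elim: t => [|t IHt]; first by rewrite mxE.
  by rewrite exprS IHt /= mxE big_ord1 mxE mulr1n.
have uE : u = c *: w by rewrite scalerA mulfV // scale1r.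
have e1 : w * minv M 0 0 = 1.
  by have /matrixP/(_ 0 0) := mulmxV_series M1; rewrite mxE big_ord1 [M _ _]mxE [RHS]mxE !mulr1n.
have e2 : minv M 0 0 * w = 1.
  by have /matrixP/(_ 0 0) := mulVmx_series M1; rewrite mxE big_ord1 [M _ _]mxE [RHS]mxE !mulr1n.
clearbody M w; by rewrite invE {1 2}uE -!scalerAl -!scalerAr !scalerA ?mulVf ?mulfV // e1 e2 !scale1r.
Qed.

End Neumann.

(** * Determinants of even matrices *)

Section EvenSubring.
Variables (T : finType) (par : T -> bool).
Notation R := (sring par).

Lemma even_mulC (f g : R) : shomog par false f -> shomog par false g -> f * g = g * f.
Proof. by move=> f0 g0; rewrite (supercomm f0 g0) scale1r. Qed.

Definition even_pred : {pred R} := fun f => `[< shomog par false f >].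

Fact even_pred_subring : subring_closed even_pred.
Proof.
split=> [|f g /asboolP f0 /asboolP g0|f g /asboolP f0 /asboolP g0]; apply/asboolP.
- exact: shomog1.
- exact/shomogD/shomogN.
- exact: shomogM f0 g0.
Qed.
HB.instance Definition _ := GRing.isSubringClosed.Build R even_pred even_pred_subring.

(** A commutative ring, so that determinant theory is available over it. [evmxP] lifts a matrix with
    even entries to this ring, and [det_map_mx] carries the identities back. *)
Record evenser := EvenSer { even_val : R; _ : even_val \in even_pred }.
HB.instance Definition _ := [isSub for even_val].
HB.instance Definition _ := [Choice of evenser by <:].
HB.instance Definition _ := [SubChoice_isSubNzRing of evenser by <:].

Lemma evenserP (x : evenser) : shomog par false (val x).
Proof. by case: x => f /= /asboolP. Qed.

Fact evenser_mulC : @commutative evenser evenser *%R.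
Proof.
move=> x y; apply/val_inj; rewrite !rmorphM /=.
by apply: even_mulC; apply: evenserP.
Qed.
HB.instance Definition _ := GRing.PzRing_hasCommutativeMul.Build evenser evenser_mulC.

Definition evmx a b (M : 'M[R]_(a, b)) := forall i j, shomog par false (M i j).
Definition odmx a b (M : 'M[R]_(a, b)) := forall i j, shomog par true (M i j).

Lemma evmxP a b (M : 'M[R]_(a, b)) : evmx M ->
  exists M0 : 'M[evenser]_(a, b), M = map_mx (val : evenser -> R) M0.
Proof.
move=> Me; exists (\matrix_(i, j) insubd 0 (M i j)); apply/matrixP => i j.
by rewrite !mxE insubdK //; apply/asboolP/Me.
Qed.

Lemma evmx1 p : evmx (1%:M : 'M[R]_p).
Proof. exact: (@mxeven1 _ par p (fun=> false)). Qed.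

Lemma evmx0 a b : evmx (0 : 'M[R]_(a, b)).
Proof. by move=> i j; rewrite mxE; apply: shomog0. Qed.

Lemma evmxN a b (M : 'M[R]_(a, b)) : evmx M -> evmx (- M).
Proof. exact: (@mxevenN _ par a b (fun=> false) (fun=> false) M). Qed.

Lemma evmxB a b (M N : 'M[R]_(a, b)) : evmx M -> evmx N -> evmx (M - N).
Proof. exact: (@mxevenB _ par a b (fun=> false) (fun=> false) M N). Qed.

Lemma evmxM a b c (M : 'M[R]_(a, b)) (N : 'M[R]_(b, c)) : evmx M -> evmx N -> evmx (M *m N).
Proof. exact: (@mxevenM _ par a b c (fun=> false) (fun=> false) (fun=> false) M N). Qed.

Lemma odmxM a b c (M : 'M[R]_(a, b)) (N : 'M[R]_(b, c)) : odmx M -> odmx N -> evmx (M *m N).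
Proof. exact: (@mxevenM _ par a b c (fun=> false) (fun=> true) (fun=> false) M N). Qed.

Lemma ev_odmxM a b c (M : 'M[R]_(a, b)) (N : 'M[R]_(b, c)) : evmx M -> odmx N -> odmx (M *m N).
Proof. exact: (@mxevenM _ par a b c (fun=> false) (fun=> false) (fun=> true) M N). Qed.

Lemma evmx_block p q (A : 'M[R]_p) (B : 'M[R]_(p, q)) (C : 'M[R]_(q, p)) (D : 'M[R]_q) :
  evmx A -> evmx B -> evmx C -> evmx D -> evmx (block_mx A B C D).
Proof.
move=> Ae Be Ce De i j; rewrite /block_mx mxE; case: (split i) => i'; rewrite mxE;
  case: (split j) => j'; [exact: Ae|exact: Be|exact: Ce|exact: De].
Qed.

Lemma evmx_inv p (M : 'M[R]_p) : evmx M -> evmx (minv M).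
Proof. exact: (@mxeven_inv _ par p (fun=> false) M). Qed.

Lemma odmx_vanish a b (M : 'M[R]_(a, b)) : odmx M -> mxvanish 1 M.
Proof. by move=> Mo i j; apply/vanish1P/(shomogP (@Mo i j)); rewrite mpar0. Qed.

Lemma evmx_det p (M : 'M[R]_p) : evmx M -> shomog par false (\det M).
Proof.
by case/evmxP=> M0 ->; rewrite det_map_mx; apply: evenserP.
Qed.

Lemma ev_det_mulmx p (M N : 'M[R]_p) : evmx M -> evmx N -> \det (M *m N) = \det M * \det N.
Proof.
case/evmxP=> M0 -> /evmxP[N0 ->].
by rewrite -map_mxM !det_map_mx det_mulmx rmorphM.
Qed.

Lemma ser_det1 p : \det (1%:M : 'M[R]_p) = 1.
Proof. by rewrite -(map_mx1 (val : evenser -> R)) det_map_mx det1 rmorph1. Qed.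

Lemma ser_det_mx00 (M : 'M[R]_0) : \det M = 1.
Proof. by rewrite (flatmx0 M) -(flatmx0 1%:M) ser_det1. Qed.

Lemma ev_det_mx11 (M : 'M[R]_1) : evmx M -> \det M = M 0 0.
Proof. by case/evmxP=> M0 ->; rewrite det_map_mx det_mx11 mxE. Qed.

Lemma ev_det_tr p (M : 'M[R]_p) : evmx M -> \det M^T = \det M.
Proof. by case/evmxP=> M0 ->; rewrite map_trmx !det_map_mx det_tr. Qed.

Lemma ev_det_lblock p q (A : 'M[R]_p) (C : 'M[R]_(q, p)) (D : 'M[R]_q) :
  evmx A -> evmx C -> evmx D -> \det (block_mx A 0 C D) = \det A * \det D.
Proof.
case/evmxP=> A0 -> /evmxP[C0 ->] /evmxP[D0 ->].
by rewrite -(map_mx0 (val : evenser -> R)) -map_block_mx !det_map_mx det_lblock rmorphM.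
Qed.

Lemma ev_det_ublock p q (A : 'M[R]_p) (B : 'M[R]_(p, q)) (D : 'M[R]_q) :
  evmx A -> evmx B -> evmx D -> \det (block_mx A B 0 D) = \det A * \det D.
Proof.
case/evmxP=> A0 -> /evmxP[B0 ->] /evmxP[D0 ->].
by rewrite -(map_mx0 (val : evenser -> R)) -map_block_mx !det_map_mx det_ublock rmorphM.
Qed.

(** * The determinant identity for odd rectangular matrices *)

Section OddDeterminant.

Let det_swap n m := forall (P : 'M[R]_(n, m)) (Q : 'M[R]_(m, n)), odmx P -> odmx Q ->
  \det (1%:M - P *m Q) * \det (1%:M - Q *m P) = 1.

Let det_swapC n m : det_swap n m -> det_swap m n.
Proof.
move=> H P Q Po Qo; rewrite even_mulC ?H //; apply/evmx_det/evmxB/odmxM => //; exact: evmx1.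
Qed.

Let det_swap_n0 n : det_swap n 0.
Proof.
by move=> P Q _ _; rewrite (thinmx0 P) (flatmx0 Q) mul0mx subr0 ser_det1 mul1r ser_det_mx00.
Qed.

(** For odd scalars qp = -pq and (pq)^2 = 0, so the product is (1 - pq)(1 + pq) = 1. *)
Let det_swap_11 : det_swap 1 1.
Proof.
move=> P Q PO QO; have Po := @PO 0 0; have Qo := @QO 0 0.
rewrite !ev_det_mx11; try by apply/evmxB/odmxM => //; apply: evmx1.
rewrite !mxE !big_ord1 eqxx; set p := P 0 0 in Po *; set q := Q 0 0 in Qo *.
have qp : q * p = - (p * q) by rewrite (supercomm Qo Po) scaleN1r.
have pq2 : p * q * (p * q) = 0.
  by rewrite -mulrA (mulrA q) qp mulNr mulrN !mulrA (odd_sqr0 Po) !mul0r oppr0.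
by rewrite qp opprK mulrDr mulr1 mulrBl mul1r pq2 subr0 subrK.
Qed.

(** Write P = (p, P1) and let Q have rows q, Q1. With W = 1 - P1 Q1 and Z = 1 - Q1 P1, the two
    determinants are det W det(1 - W^-1 p q) and det(1 - q W^-1 p) det Z. The inner factors cancel
    by the one-column case for W^-1 p and q, the outer ones by the case of P1 and Q1. *)
Let det_swap_step n m : det_swap n m -> det_swap n 1 -> det_swap n (1 + m).
Proof.
move=> Hm H1 P Q; rewrite -(hsubmxK P) -(vsubmxK Q).
set p := lsubmx P; set P1 := rsubmx P; set q := usubmx Q; set Q1 := dsubmx Q.
move=> Po Qo.
have po : odmx p by move=> i j; have := @Po i (lshift m j); rewrite row_mxEl.
have P1o : odmx P1 by move=> i j; have := @Po i (rshift 1 j); rewrite row_mxEr.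
have qo : odmx q by move=> i j; have := @Qo (lshift m i) j; rewrite col_mxEu.
have Q1o : odmx Q1 by move=> i j; have := @Qo (rshift 1 i) j; rewrite col_mxEd.
clearbody p P1 q Q1 => {P Q Po Qo}.
rewrite mul_row_col mul_col_row scalar_mx_block opp_block_mx add_block_mx !add0r.
pose W := 1%:M - P1 *m Q1; pose Z := 1%:M - Q1 *m P1.
have We : evmx W by apply/evmxB/odmxM => //; apply: evmx1.
have Ze : evmx Z by apply/evmxB/odmxM => //; apply: evmx1.
have W1 : mxvanish 1 (1%:M - W).
  by rewrite /W opprB addrC subrK; apply/mxvanishMr/odmx_vanish.
have Z1 : mxvanish 1 (1%:M - Z).
  by rewrite /Z opprB addrC subrK; apply/mxvanishMr/odmx_vanish.
(* Woodbury's formula, from W P1 = P1 Z. *)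
have WiE : minv W = 1%:M + P1 *m minv Z *m Q1.
  symmetry; apply: minv_uniquer => //; rewrite mulmxDr mulmx1 !mulmxA.
  have -> : W *m P1 = P1 *m Z by rewrite mulmxBl mulmxBr mul1mx mulmx1 mulmxA.
  by rewrite -(mulmxA P1) mulmxV_series // mulmx1 subrK.
have Wie := evmx_inv We; have Zie := evmx_inv Ze.
have Wpo : odmx (minv W *m p) by apply: ev_odmxM.
have -> : 1%:M - (p *m q + P1 *m Q1) = W *m (1%:M - minv W *m p *m q).
  rewrite mulmxBr mulmx1 !mulmxA mulmxV_series // mul1mx /W.
  by rewrite opprD addrA addrAC.
(* Block elimination with the pivot Z: the upper left corner becomes 1 - q p - q P1 Z^-1 Q1 p, which
   is 1 - q W^-1 p by [WiE]. *)
have -> : block_mx (1%:M - q *m p) (- (q *m P1)) (- (Q1 *m p)) (1%:M - Q1 *m P1) =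
    block_mx 1%:M (- (q *m P1 *m minv Z)) 0 1%:M *m
    block_mx (1%:M - q *m (minv W *m p)) 0 (- (Q1 *m p)) Z.
  rewrite mulmx_block !mul1mx !mul0mx !add0r; congr block_mx.
    rewrite WiE mulmxDl mul1mx mulmxDr mulNmx mulmxN opprK opprD !mulmxA.
    by rewrite addrA subrK.
  by rewrite mulNmx -(mulmxA _ (minv Z)) mulVmx_series // mulmx1.
have e1 := evmx1; have qWe : evmx (q *m (minv W *m p)) by apply: odmxM.
have Wqe : evmx (minv W *m p *m q) by apply: odmxM.
have qZe : evmx (q *m P1 *m minv Z) by apply: evmxM Zie; apply: odmxM.
have Qpe : evmx (Q1 *m p) by apply: odmxM.
rewrite ev_det_mulmx //; last exact: evmxB.
rewrite ev_det_mulmx; first last.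
- by apply: evmx_block => //; [apply: evmxB|apply: evmx0|apply: evmxN].
- by apply: evmx_block => //; [apply: evmxN|apply: evmx0].
rewrite ev_det_ublock // ?ev_det_lblock //; [|exact: evmxB|exact: evmxN|exact: evmxN].
rewrite !ser_det1 !mul1r mulrA -(mulrA (\det W)) H1 // mulr1.
exact: Hm.
Qed.

(** Odd counterpart of Sylvester's det(1 - PQ) = det(1 - QP), in which anticommutation makes the two
    sides inverse to each other. The one-column case needed by the step is the transposed size of
    the one-row case, itself built up from size 1 x 1. *)
Lemma det_odd_swap n m (P : 'M[R]_(n, m)) (Q : 'M[R]_(m, n)) : odmx P -> odmx Q ->
  \det (1%:M - P *m Q) * \det (1%:M - Q *m P) = 1.
Proof.
have H1 k : det_swap k 1.
  apply: det_swapC; elim: k => [|k IHk]; first exact: det_swap_n0.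
  exact: det_swap_step IHk det_swap_11.
move: P Q; rewrite -/(det_swap n m); elim: m => [|m IHm]; first exact: det_swap_n0.
exact: det_swap_step IHm (H1 n).
Qed.

End OddDeterminant.
End EvenSubring.

(** * Morphisms, counit and parity *)

Section MorphismTheory.
Variables (cj : CC -> CC) (T U : finType) (parT : T -> bool) (parU : U -> bool).
Variable s : smorph cj parT parU.

(** Continuity alone gives this: f minus its constant term has order at least 1, hence so has its
    image. *)
Lemma seps_sm (f : sring parT) : seps (s f : sring parU) = cj (seps f).
Proof.
have f1 : vanish 1 (f - seps f *: 1).
  apply/vanish1P; rewrite -[LHS]/(f (mon0 T) - f (mon0 T) * (if mon0 T == mon0 T then 1 else 0)).
  by rewrite eqxx mulr1 subrr.
have /vanish1P := sm_vanish s f1; rewrite smB smZ sm1 /seps.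
rewrite -[LHS]/(s f (mon0 U) - cj (f (mon0 T)) * (if mon0 U == mon0 U then 1 else 0)).
by rewrite eqxx mulr1 => /eqP; rewrite subr_eq0 => /eqP.
Qed.

Lemma smZ_sign (b : bool) (f : sring parT) : s ((-1) ^+ b *: f) = (-1) ^+ b *: s f.
Proof. by case: b; rewrite ?scaleN1r ?scale1r ?rmorphN. Qed.

(** [s] commutes with the parity involutions as soon as it does so on generators, and homogeneity is
    an eigenvector equation for them. *)
Lemma sm_shomog p (f : sring parT) : (forall v, shomog parU (parT v) (s (svar v))) ->
  svalid parT f -> shomog parT p f -> shomog parU p (s f).
Proof.
move=> sv fv /sm_sgnP fp; apply/sm_sgnP; rewrite -smZ_sign -fp.
apply: (sm_eq (s := sm_comp (sm_sgn parU) s) (t := sm_comp s (sm_sgn parT))) fv => // v.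
rewrite -[LHS]/(sm_sgn parU (s (svar v))) -[RHS]/(s (sm_sgn parT (svar v))).
rewrite ((sm_sgnP _ _).1 (@sv v)) ((sm_sgnP _ _).1 (@shomog_svar _ parT v)).
by rewrite smZ_sign.
Qed.

End MorphismTheory.

(** * Supertranspose *)

Section Supertranspose.
Variables (T : finType) (par : T -> bool) (p : nat) (q : 'I_p -> bool).
Implicit Types M N : 'M[sring par]_p.

Definition strans M : 'M[sring par]_p :=
  \matrix_(i, j) ((-1) ^+ ((q i (+) q j) && q j) *: M j i).

Lemma strans1 : strans 1%:M = 1%:M.
Proof.
apply/matrixP => i j; rewrite !mxE [j == i]eq_sym.
by case: eqP => [->|_]; rewrite ?addbb ?scale1r ?scaler0.
Qed.

(** Transposition exchanges two factors of parities |j| + |k| and |k| + |i|. Their supercommutation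
    sign turns the sign at (i, j) into the product of the signs at (i, k) and (k, j). *)
Lemma strans_mul M N : mxeven q q M -> mxeven q q N -> strans (M *m N) = strans N *m strans M.
Proof.
move=> Me Ne; apply/matrixP => i j; rewrite !mxE scaler_sumr; apply: eq_bigr => k _.
rewrite !mxE -scalerAl -scalerAr (supercomm (@Me j k) (@Ne k i)) !scalerA.
congr (_ *: _); rewrite -!signr_addb; congr (_ ^+ _).
by case: (q i); case: (q j); case: (q k).
Qed.

Lemma stransK M : strans (strans M) = \matrix_(i, j) ((-1) ^+ (q i (+) q j) *: M i j).
Proof.
apply/matrixP => i j; rewrite !mxE scalerA -signr_addb; congr (_ ^+ _ *: _).
by case: (q i); case: (q j).
Qed.

End Supertranspose.

Lemma map_strans cj (T U : finType) (parT : T -> bool) (parU : U -> bool)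
    (s : smorph cj parT parU) p (q : 'I_p -> bool) (M : 'M[sring parT]_p) :
  map_mx s (strans q M) = strans q (map_mx s M).
Proof. by apply/matrixP => i j; rewrite !mxE smZ_sign. Qed.

Lemma mulmx_inv_uniq (R : pzRingType) p (A B C : 'M[R]_p) :
  A *m B = 1%:M -> C *m A = 1%:M -> B = C.
Proof. by move=> AB CA; rewrite -[B]mul1mx -CA -mulmxA AB mulmx1. Qed.

Lemma mxdetE (T : finType) (par : T -> bool) p (M : smx T p) :
  mxdet par M = \det (toM par M) :> sring par.
Proof.
rewrite /mxdet (ssumE (par := par)); apply: eq_bigr => s _.
rewrite sprodlE (_ : \prod_(i <- enum 'I_p) (M i (s i) : sring par) =
  \prod_i toM par M i (s i)); last first.
  by rewrite enumT [index_enum _]unlock; apply: eq_bigr => i _; rewrite mxE.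
transitivity ((-1) ^+ odd_perm s *: (\prod_i toM par M i (s i))); first by [].
by case: (odd_perm s); rewrite ?scaleN1r ?scale1r ?mulN1r ?mul1r.
Qed.

(** * The generic supermatrix and its inverse *)

Section SpecialLinear.
Variables n m : nat.
Notation vp := (@vpar n m).
Notation vp2 := (@vpar2 n m).
Notation R := (sring vp).
Notation ip := (@ipar n m).

Definition Ymx : 'M[R]_(n + m) := toM vp (@Y n m).
Local Notation A := (ulsubmx Ymx).
Local Notation B := (ursubmx Ymx).
Local Notation C := (dlsubmx Ymx).
Local Notation D := (drsubmx Ymx).
Definition schurA := A - B *m minv D *m C.
Definition schurD := D - C *m minv A *m B.

Lemma YmxE i j : Ymx i j = (i == j)%:R + (svar (i, j) : R).
Proof. by rewrite mxE /Y -[LHS]/(_ + _ : R) sconst_nat. Qed.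

Lemma Ymx_vanish : mxvanish 1 (1%:M - Ymx).
Proof.
move=> i j; rewrite mxE [X in _ + X]mxE YmxE !mxE opprD addrA subrr sub0r.
apply/vanishN/vanish1P; rewrite /svar; case: eqP => // /ffunP/(_ (i, j)).
by rewrite !ffunE eqxx.
Qed.

Lemma Ymx_even : mxeven ip ip Ymx.
Proof.
move=> i j; rewrite YmxE; apply: shomogD; last exact: (@shomog_svar _ vp (i, j)).
by case: eqP => [->|_]; [rewrite addbb; apply: shomog1|apply: shomog0].
Qed.

Lemma Ymx_valid : mxvalid Ymx.
Proof.
move=> i j; rewrite YmxE; apply: svalidD; last exact: svalid_svar.
by case: eqP => _; [apply: svalid1|apply: svalid0].
Qed.

Lemma ipar_lshift (i : 'I_n) : ip (lshift m i) = false.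
Proof. by rewrite /ipar /= leqNgt ltn_ord. Qed.

Lemma ipar_rshift (i : 'I_m) : ip (rshift n i) = true.
Proof. exact: leq_addr. Qed.

Lemma A_E i j : A i j = Ymx (lshift m i) (lshift m j). Proof. by rewrite 2!mxE. Qed.
Lemma B_E i j : B i j = Ymx (lshift m i) (rshift n j). Proof. by rewrite 2!mxE. Qed.
Lemma C_E i j : C i j = Ymx (rshift n i) (lshift m j). Proof. by rewrite 2!mxE. Qed.
Lemma D_E i j : D i j = Ymx (rshift n i) (rshift n j). Proof. by rewrite 2!mxE. Qed.

Lemma A_even : evmx A.
Proof.
move=> i j; rewrite A_E; have := @Ymx_even (lshift m i) (lshift m j).
by rewrite !ipar_lshift.
Qed.

Lemma B_odd : odmx B.
Proof.
move=> i j; rewrite B_E; have := @Ymx_even (lshift m i) (rshift n j).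
by rewrite ipar_lshift ipar_rshift.
Qed.

Lemma C_odd : odmx C.
Proof.
move=> i j; rewrite C_E; have := @Ymx_even (rshift n i) (lshift m j).
by rewrite ipar_lshift ipar_rshift.
Qed.

Lemma D_even : evmx D.
Proof.
move=> i j; rewrite D_E; have := @Ymx_even (rshift n i) (rshift n j).
by rewrite !ipar_rshift.
Qed.

Lemma A_vanish : mxvanish 1 (1%:M - A).
Proof.
move=> i j; have e1 : (1%:M : 'M[R]_n) i j = (1%:M : 'M[R]_(n + m)) (lshift m i) (lshift m j).
  by rewrite !mxE eq_lshift.
have -> : (1%:M - A) i j = (1%:M - Ymx) (lshift m i) (lshift m j).
  by rewrite [LHS]mxE [X in _ + X]mxE A_E e1 [RHS]mxE [X in _ = _ + X]mxE.
exact: Ymx_vanish.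
Qed.

Lemma D_vanish : mxvanish 1 (1%:M - D).
Proof.
move=> i j; have e1 : (1%:M : 'M[R]_m) i j = (1%:M : 'M[R]_(n + m)) (rshift n i) (rshift n j).
  by rewrite !mxE eq_rshift.
have -> : (1%:M - D) i j = (1%:M - Ymx) (rshift n i) (rshift n j).
  by rewrite [LHS]mxE [X in _ + X]mxE D_E e1 [RHS]mxE [X in _ = _ + X]mxE.
exact: Ymx_vanish.
Qed.

Lemma ev_oddM a b c d (M : 'M[R]_(a, b)) (N : 'M[R]_(b, c)) (K : 'M[R]_(c, d)) :
  odmx M -> evmx N -> odmx K -> evmx (M *m N *m K).
Proof. by move=> Mo Ne Ko; rewrite -mulmxA; apply: odmxM Mo _; apply: ev_odmxM. Qed.

Lemma schurA_even : evmx schurA.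
Proof.
by apply/evmxB/ev_oddM => //;
  [exact: A_even|exact: B_odd|apply/evmx_inv/D_even|exact: C_odd].
Qed.

Lemma schurD_even : evmx schurD.
Proof.
by apply/evmxB/ev_oddM => //;
  [exact: D_even|exact: C_odd|apply/evmx_inv/A_even|exact: B_odd].
Qed.

Lemma schurA_vanish : mxvanish 1 (1%:M - schurA).
Proof.
have -> : 1%:M - schurA = 1%:M - A - - (B *m minv D *m C) by rewrite /schurA opprD addrA.
apply: mxvanishB A_vanish _ => i j; rewrite mxE.
by apply/vanishN/mxvanishMl/odmx_vanish/C_odd.
Qed.

Lemma schurD_vanish : mxvanish 1 (1%:M - schurD).
Proof.
have -> : 1%:M - schurD = 1%:M - D - - (C *m minv A *m B) by rewrite /schurD opprD addrA.
apply: mxvanishB D_vanish _ => i j; rewrite mxE.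
by apply/vanishN/mxvanishMl/odmx_vanish/B_odd.
Qed.

Lemma toM_blkA : toM vp (@blkA n m) = A.
Proof. by apply/matrixP => i j; rewrite A_E mxE [RHS]mxE. Qed.
Lemma toM_blkB : toM vp (@blkB n m) = B.
Proof. by apply/matrixP => i j; rewrite B_E mxE [RHS]mxE. Qed.
Lemma toM_blkC : toM vp (@blkC n m) = C.
Proof. by apply/matrixP => i j; rewrite C_E mxE [RHS]mxE. Qed.
Lemma toM_blkD : toM vp (@blkD n m) = D.
Proof. by apply/matrixP => i j; rewrite D_E mxE [RHS]mxE. Qed.

Lemma toM_SchurA : toM vp (@SchurA n m) = schurA.
Proof. by rewrite toM_add toM_opp !toM_mul mxinvE toM_blkA toM_blkB toM_blkC toM_blkD. Qed.

Lemma toM_SchurD : toM vp (@SchurD n m) = schurD.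
Proof. by rewrite toM_add toM_opp !toM_mul mxinvE toM_blkA toM_blkB toM_blkC toM_blkD. Qed.

Lemma toM_Yinv : toM vp (@Yinv n m) =
  block_mx (minv schurA) (- (minv A *m B *m minv schurD)) (- (minv D *m C *m minv schurA)) (minv schurD).
Proof.
rewrite -toM_SchurA -toM_SchurD -!mxinvE -toM_blkA -toM_blkB -toM_blkC -toM_blkD -!mxinvE -!toM_mul.
apply/matrixP => i j; rewrite mxE /Yinv /block_mx mxE.
by case: (split i) => i'; rewrite mxE; case: (split j) => j'; rewrite !mxE.
Qed.

(** A right inverse is unique, so one blockwise product suffices. Afterwards the antipode is handled
    through the inverse of the whole matrix; blocks return only for the superdeterminant. *)
Lemma Yinv_minv : toM vp (@Yinv n m) = minv Ymx.
Proof.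
apply: minv_uniquer; first exact: Ymx_vanish.
rewrite toM_Yinv -{1}(submxK Ymx) mulmx_block scalar_mx_block.
have eA : A *m minv schurA - B *m (minv D *m C *m minv schurA) = 1%:M.
  by rewrite !mulmxA -mulmxBl mulmxV_series //; apply: schurA_vanish.
have eD : D *m minv schurD - C *m (minv A *m B *m minv schurD) = 1%:M.
  by rewrite !mulmxA -mulmxBl mulmxV_series //; apply: schurD_vanish.
rewrite !mulmxN eA; congr block_mx; last by rewrite addrC.
- by rewrite !mulmxA mulmxV_series ?mul1mx ?addNr //; apply: A_vanish.
- by rewrite !mulmxA mulmxV_series ?mul1mx ?subrr //; apply: D_vanish.
Qed.

Definition Yinvmx := minv Ymx.

Lemma mulYYi : Ymx *m Yinvmx = 1%:M. Proof. exact: mulmxV_series Ymx_vanish. Qed.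
Lemma mulYiY : Yinvmx *m Ymx = 1%:M. Proof. exact: mulVmx_series Ymx_vanish. Qed.
Lemma Yinvmx_even : mxeven ip ip Yinvmx. Proof. exact/mxeven_inv/Ymx_even. Qed.
Lemma Yinvmx_valid : mxvalid Yinvmx. Proof. exact/mxvalid_inv/Ymx_valid. Qed.

Lemma YinvE i j : @Yinv n m i j = Yinvmx i j :> R.
Proof. by rewrite /Yinvmx -Yinv_minv [RHS]mxE. Qed.

Definition S_img : V n m -> R := @S_gen n m.
Definition sigma_img : V n m -> R := @sigma_gen n m.

Lemma S_imgE v : S_img v = Yinvmx v.1 v.2 - (v.1 == v.2)%:R.
Proof.
rewrite /S_img /S_gen -[LHS]/((sconst _ : R) + (Yinv v.1 v.2 : R)) YinvE addrC; congr (_ + _).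
by rewrite sconstE scaleNr scaler_nat.
Qed.

Lemma sigma_imgE v : sigma_img v = (-1) ^+ (vpar v && ip v.2) *: S_img (v.2, v.1).
Proof. by []. Qed.

Lemma S_img_homog v : shomog vp (vp v) (S_img v).
Proof.
rewrite S_imgE; apply: shomogD; first exact: Yinvmx_even.
apply: shomogN; rewrite /vpar.
by case: eqP => [->|_]; [rewrite addbb; apply: shomog1|apply: shomog0].
Qed.

Lemma sigma_img_homog v : shomog vp (vp v) (sigma_img v).
Proof.
rewrite sigma_imgE; apply: shomogZ; have := @S_img_homog (v.2, v.1).
by rewrite /vpar /= addbC.
Qed.

Lemma S_img0 v : S_img v (mon0 _) = 0.
Proof.
apply/vanish1P; rewrite S_imgE -opprB; apply: vanishN.
by have := @minv_vanish _ _ _ _ Ymx_vanish v.1 v.2; rewrite mxE [X in _ + X]mxE mxE.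
Qed.

Lemma sigma_img0 v : sigma_img v (mon0 _) = 0.
Proof. by apply/vanish1P; rewrite sigma_imgE; apply/vanishZ/vanish1P/S_img0. Qed.

Lemma S_img_valid v : svalid vp (S_img v).
Proof.
rewrite S_imgE; apply: svalidD; first exact: Yinvmx_valid.
by apply: svalidN; case: eqP => _; [apply: svalid1|apply: svalid0].
Qed.

Lemma sigma_img_valid v : svalid vp (sigma_img v).
Proof. by rewrite sigma_imgE; apply/svalidZ/S_img_valid. Qed.

Definition S_morph : smorph idfun vp vp := @sm_subst _ _ _ _ S_img S_img_homog S_img0 idfun.
Definition sigma_morph : smorph (Num.conj : {rmorphism CC -> CC}) vp vp :=
  @sm_subst _ _ _ _ sigma_img sigma_img_homog sigma_img0 (Num.conj : {rmorphism CC -> CC}).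

Lemma S_morphE f : Santi f = S_morph f.
Proof. exact: (antisubstE S_img_homog). Qed.

Lemma map_S_morph_Y : map_mx S_morph Ymx = Yinvmx.
Proof.
apply/matrixP => i j; rewrite mxE YmxE rmorphD rmorph_nat.
by rewrite -[X in _ + X]/(sm_subst _ _ _ (svar _)) sm_subst_svar S_imgE /= addrC subrK.
Qed.

Lemma map_sigma_morph_Y : map_mx sigma_morph Ymx = strans ip Yinvmx.
Proof.
apply/matrixP => i j; rewrite [LHS]mxE YmxE rmorphD rmorph_nat.
rewrite -[X in _ + X]/(sm_subst _ _ _ (svar _)) sm_subst_svar sigma_imgE S_imgE /= [RHS]mxE scalerBr.
rewrite eq_sym; case: (j =P i) => [->|_]; last by rewrite !mulr0n scaler0 add0r subr0.
by rewrite /vpar /= addbb !scale1r addrC subrK.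
Qed.

End SpecialLinear.

(** * The structure maps on the generic matrix *)

Section StructureMaps.
Variables n m : nat.
Notation vp := (@vpar n m).
Notation vp2 := (@vpar2 n m).
Notation R := (sring vp).
Notation R2 := (sring vp2).
Notation ip := (@ipar n m).
Notation Ymx := (Ymx n m).
Notation Yinvmx := (Yinvmx n m).
Notation S_morph := (S_morph n m).
Notation sigma_morph := (sigma_morph n m).

Lemma sm_eqY cj cj' (U : finType) (parU : U -> bool) (s : smorph cj vp parU)
    (t : smorph cj' vp parU) : cj =1 cj' -> map_mx s Ymx = map_mx t Ymx ->
  forall f : R, svalid vp f -> s f = t f.
Proof.
move=> cjE st; apply: sm_eq => // -[i j]; move/matrixP/(_ i j): st.
rewrite [LHS]mxE [RHS]mxE YmxE (rmorphD s) (rmorphD t) (rmorph_nat s) (rmorph_nat t).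
exact: addrI.
Qed.

Lemma sigma_morph_Yinvmx : map_mx sigma_morph Yinvmx = strans ip Ymx.
Proof.
apply: (mulmx_inv_uniq (A := map_mx sigma_morph Ymx)).
  by rewrite -map_mxM mulYYi map_mx1.
rewrite map_sigma_morph_Y -strans_mul ?mulYiY ?strans1 //; [exact: Yinvmx_even|exact: Ymx_even].
Qed.

Lemma S_morph_Yinvmx : map_mx S_morph Yinvmx = Ymx.
Proof.
apply: (mulmx_inv_uniq (A := map_mx S_morph Ymx)).
  by rewrite -map_mxM mulYYi map_mx1.
by rewrite map_S_morph_Y mulYYi.
Qed.

(** Explains the signs of (5b) and (6b): on the generic matrix the parity involution is the double
    supertranspose. *)
Lemma map_sgn_Y : map_mx (sm_sgn vp) Ymx = strans ip (strans ip Ymx).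
Proof.
apply/matrixP => i j; rewrite stransK [LHS]mxE [RHS]mxE.
exact/sm_sgnP/Ymx_even.
Qed.

Lemma conjCK_fun : (Num.conj : CC -> CC) \o Num.conj =1 idfun.
Proof. exact: conjCK. Qed.

(** On generators, sigma takes Y to (Y^-1)^st, and Y^-1 to Y^st; it commutes with st, so its square
    takes Y to (Y^st)^st. *)
Lemma sigma_sigma p f : svalid vp f -> shomog vp p f ->
  sigma (sigma f) = (-1) ^+ p *: (f : R) :> R.
Proof.
move=> fv /sm_sgnP <-.
apply: (sm_eqY (s := sm_comp sigma_morph sigma_morph) (t := sm_sgn vp) conjCK_fun) fv.
rewrite (map_mx_comp sigma_morph sigma_morph) map_sgn_Y.
by rewrite map_sigma_morph_Y map_strans sigma_morph_Yinvmx.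
Qed.

(** Here S after sigma takes Y to Y^st, because S takes Y^-1 back to Y; applied twice, it gives
    (Y^st)^st. *)
Lemma S_sigma_S_sigma p f : svalid vp f -> shomog vp p f ->
  Santi (sigma (Santi (sigma f))) = (-1) ^+ p *: (f : R) :> R.
Proof.
move=> fv /sm_sgnP <-; rewrite !S_morphE.
apply: (sm_eqY (s := sm_comp (sm_comp S_morph sigma_morph) (sm_comp S_morph sigma_morph))
  (t := sm_sgn vp)) fv.
  exact: conjCK_fun.
rewrite (map_mx_comp (sm_comp S_morph sigma_morph) (sm_comp S_morph sigma_morph))
  !(map_mx_comp sigma_morph S_morph) map_sgn_Y.
by rewrite map_sigma_morph_Y map_strans S_morph_Yinvmx map_strans map_sigma_morph_Y !map_strans S_morph_Yinvmx.
Qed.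

(* [sL] and [sR] stand for the embeddings a |-> a (x) 1 and a |-> 1 (x) a, [sD] for the coproduct. *)
Section Coproduct.
Variables (sL sR sD : smorph idfun vp vp2) (s2 : smorph (Num.conj : CC -> CC) vp2 vp2).
Hypothesis sL_homog : forall v, shomog vp2 (vp v) (sL (svar v)).
Hypothesis sR_homog : forall v, shomog vp2 (vp v) (sR (svar v)).
Hypothesis sDE : forall v, sD (svar v) =
  sL (svar v) + sR (svar v) + \sum_k sL (svar (v.1, k)) * sR (svar (k, v.2)).
Hypothesis s2L : forall v, s2 (sL (svar v)) = sL (sigma_morph (svar v)).
Hypothesis s2R : forall v, s2 (sR (svar v)) = sR (sigma_morph (svar v)).

Lemma map_coproduct_Y : map_mx sD Ymx = map_mx sL Ymx *m map_mx sR Ymx.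
Proof.
pose X (s : smorph idfun vp vp2) : 'M[R2]_(n + m) := \matrix_(i, j) s (svar (i, j)).
have XE s i j : X s i j = s (svar (i, j)) by rewrite mxE.
have eY (s : smorph idfun vp vp2) : map_mx s Ymx = 1%:M + X s.
  apply/matrixP => i j; rewrite [LHS]mxE YmxE (rmorphD s) (rmorph_nat s) [RHS]mxE XE.
  by rewrite [in RHS]mxE.
rewrite !eY; transitivity (1%:M + (X sL + X sR + X sL *m X sR)); last first.
  rewrite mulmxDl !mulmxDr !mul1mx mulmx1 -!addrA; congr (_ + _); exact: addrCA.
congr (_ + _); apply/matrixP => i j.
rewrite [RHS]mxE [X in _ = X + _]mxE [X in _ = _ + X]mxE !XE sDE; congr (_ + _).
by apply: eq_bigr => k _; rewrite !XE.
Qed.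

Lemma map_coproduct_Yinvmx : map_mx sD Yinvmx = map_mx sR Yinvmx *m map_mx sL Yinvmx.
Proof.
symmetry; apply: (mulmx_inv_uniq (A := map_mx sD Ymx)); last first.
  by rewrite -map_mxM mulYiY map_mx1.
rewrite map_coproduct_Y mulmxA -(mulmxA (map_mx sL Ymx)) -(map_mxM sR) mulYYi map_mx1 mulmx1.
by rewrite -map_mxM mulYYi map_mx1.
Qed.

Lemma map_s2_embedding (s : smorph idfun vp vp2) :
    (forall v, s2 (s (svar v)) = s (sigma_morph (svar v))) ->
  map_mx s2 (map_mx s Ymx) = strans ip (map_mx s Yinvmx).
Proof.
move=> ss; rewrite -map_strans -map_sigma_morph_Y -(map_mx_comp s s2) -(map_mx_comp sigma_morph s).
apply/matrixP => i j; rewrite [LHS]mxE [RHS]mxE.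
exact: (sm_eq (s := sm_comp s2 s) (t := sm_comp s sigma_morph)) (@Ymx_valid _ _ i j).
Qed.

(** Two reversals of order cancel. Delta(Y^-1) is the product of the right copy of Y^-1 by the left
    one, and its supertranspose puts the left copy first again, as in the image of the product of
    the two copies of Y. *)
Lemma sm_coproduct (f : R) : svalid vp f -> s2 (sD f) = sD (sigma_morph f).
Proof.
move=> fv; apply: (sm_eqY (s := sm_comp s2 sD) (t := sm_comp sD sigma_morph)) fv => //.
rewrite (map_mx_comp sD s2) (map_mx_comp sigma_morph sD) map_coproduct_Y map_mxM !map_s2_embedding //.
rewrite map_sigma_morph_Y map_strans map_coproduct_Yinvmx strans_mul // => i j; rewrite mxE.
  by apply: sm_shomog sR_homog _ _; [apply: Yinvmx_valid|apply: Yinvmx_even].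
by apply: sm_shomog sL_homog _ _; [apply: Yinvmx_valid|apply: Yinvmx_even].
Qed.

End Coproduct.

(** * The coproduct and the embeddings of the tensor factors *)

Definition varL (v : V n m) : R2 := svar (inl v).
Definition varR (v : V n m) : R2 := svar (inr v).
Definition Delta_img (v : V n m) : R2 := Delta_gen v.

Lemma varL_homog v : shomog vp2 (vp v) (varL v).
Proof. exact: (@shomog_svar _ vp2 (inl v)). Qed.
Lemma varR_homog v : shomog vp2 (vp v) (varR v).
Proof. exact: (@shomog_svar _ vp2 (inr v)). Qed.

Lemma svar0 (T : finType) (v : T) : svar v (mon0 T) = 0.
Proof. by rewrite /svar; case: eqP => // /ffunP/(_ v); rewrite !ffunE eqxx. Qed.

Definition embL_morph : smorph idfun vp vp2 :=
  @sm_subst _ _ _ _ varL varL_homog (fun v => svar0 (inl v)) idfun.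
Definition embR_morph : smorph idfun vp vp2 :=
  @sm_subst _ _ _ _ varR varR_homog (fun v => svar0 (inr v)) idfun.

Lemma Delta_imgE v : Delta_img v = varL v + varR v + \sum_k varL (v.1, k) * varR (k, v.2).
Proof. by rewrite /Delta_img /Delta_gen (ssumE (par := vp2)). Qed.

Lemma Delta_img_homog v : shomog vp2 (vp v) (Delta_img v).
Proof.
rewrite Delta_imgE; apply: shomogD; first by apply: shomogD; [exact: varL_homog|exact: varR_homog].
apply: shomog_sum => k _; have := shomogM (@varL_homog (v.1, k)) (@varR_homog (k, v.2)).
by rewrite /vpar /= addbA -[_ (+) _ (+) ip k]addbA addbb addbF.
Qed.

Lemma Delta_img0 v : Delta_img v (mon0 _) = 0.
Proof.
apply/vanish1P; rewrite Delta_imgE; apply: vanishD.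
  by apply: vanishD; apply/vanish1P; apply: svar0.
by apply: vanish_sum => k _; apply/vanishMr/vanish1P/svar0.
Qed.

Definition Delta_morph : smorph idfun vp vp2 :=
  @sm_subst _ _ _ _ Delta_img Delta_img_homog Delta_img0 idfun.

Definition sigma2_img (w : V2 n m) : R2 :=
  match w with inl v => embL_morph (sigma_img v) | inr v => embR_morph (sigma_img v) end.

Lemma embL_morph_homog p (f : R) : svalid vp f -> shomog vp p f -> shomog vp2 p (embL_morph f).
Proof. by apply: sm_shomog => v; rewrite sm_subst_svar; apply: varL_homog. Qed.
Lemma embR_morph_homog p (f : R) : svalid vp f -> shomog vp p f -> shomog vp2 p (embR_morph f).
Proof. by apply: sm_shomog => v; rewrite sm_subst_svar; apply: varR_homog. Qed.

Lemma sigma2_img_homog w : shomog vp2 (vp2 w) (sigma2_img w).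
Proof.
by case: w => v; [apply: embL_morph_homog|apply: embR_morph_homog];
  apply: sigma_img_valid || apply: sigma_img_homog.
Qed.

Lemma sigma2_img0 w : sigma2_img w (mon0 _) = 0.
Proof. by apply/vanish1P; case: w => v; apply/sm_vanish/vanish1P/sigma_img0. Qed.

Definition sigma2_morph : smorph (Num.conj : {rmorphism CC -> CC}) vp2 vp2 :=
  @sm_subst _ _ _ _ sigma2_img sigma2_img_homog sigma2_img0 (Num.conj : {rmorphism CC -> CC}).

Lemma sigma_morph_svar v : sigma_morph (svar v) = sigma_img v. Proof. exact: sm_subst_svar. Qed.
Lemma embL_morph_svar v : embL_morph (svar v) = varL v. Proof. exact: sm_subst_svar. Qed.
Lemma embR_morph_svar v : embR_morph (svar v) = varR v. Proof. exact: sm_subst_svar. Qed.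
Lemma Delta_morph_svar v : Delta_morph (svar v) = Delta_img v. Proof. exact: sm_subst_svar. Qed.
Lemma sigma2_morph_svar w : sigma2_morph (svar w) = sigma2_img w. Proof. exact: sm_subst_svar. Qed.

Lemma sigma2_Delta f : svalid vp f -> sigma2 (Delta f) = Delta (sigma f).
Proof.
move=> fv; rewrite -[LHS]/(sigma2_morph (Delta_morph f)) -[RHS]/(Delta_morph (sigma_morph f)).
apply: (sm_coproduct (sL := embL_morph) (sR := embR_morph)) fv => v.
- rewrite embL_morph_svar; exact: varL_homog.
- rewrite embR_morph_svar; exact: varR_homog.
- rewrite [LHS]Delta_morph_svar Delta_imgE.
  rewrite [X in _ = X + _ + _]embL_morph_svar [X in _ = _ + X + _]embR_morph_svar.
  congr (_ + _); apply: eq_bigr => k _.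
  by rewrite [X in _ = X * _]embL_morph_svar [X in _ = _ * X]embR_morph_svar.
- by rewrite embL_morph_svar sigma_morph_svar sigma2_morph_svar.
- by rewrite embR_morph_svar sigma_morph_svar sigma2_morph_svar.
Qed.

(** * The superdeterminant and the stability of its ideal *)

Local Notation A := (ulsubmx Ymx).
Local Notation B := (ursubmx Ymx).
Local Notation C := (dlsubmx Ymx).
Local Notation D := (drsubmx Ymx).
Local Notation schurA := (schurA n m).
Local Notation schurD := (schurD n m).

Lemma Yinvmx_block : Yinvmx =
  block_mx (minv schurA) (- (minv A *m B *m minv schurD)) (- (minv D *m C *m minv schurA)) (minv schurD).
Proof. by rewrite -toM_Yinv Yinv_minv. Qed.

Lemma det_SchurA : \det schurA = \det A * \det (1%:M - (minv A *m B) *m (minv D *m C)).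
Proof.
have Pe : evmx (minv A *m B *m (minv D *m C)).
  by apply: odmxM; apply: ev_odmxM;
  first [exact: B_odd|exact: C_odd|exact/evmx_inv/A_even|exact/evmx_inv/D_even].
rewrite -ev_det_mulmx; [|exact: A_even|exact: evmxB (@evmx1 _ _ _) Pe].
by rewrite mulmxBr mulmx1 !mulmxA mulmxV_series ?mul1mx //; apply: A_vanish.
Qed.

Lemma det_SchurD : \det schurD = \det D * \det (1%:M - (minv D *m C) *m (minv A *m B)).
Proof.
have Pe : evmx (minv D *m C *m (minv A *m B)).
  by apply: odmxM; apply: ev_odmxM;
  first [exact: B_odd|exact: C_odd|exact/evmx_inv/A_even|exact/evmx_inv/D_even].
rewrite -ev_det_mulmx; [|exact: D_even|exact: evmxB (@evmx1 _ _ _) Pe].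
by rewrite mulmxBr mulmx1 !mulmxA mulmxV_series ?mul1mx //; apply: D_vanish.
Qed.

(** Factoring A and D out of the Schur complements leaves the two mutually inverse determinants of
    [det_odd_swap]; the rest is a rearrangement of even, hence commuting, factors. *)
Lemma det_Schur : \det schurD * \det schurA = \det A * \det D.
Proof.
have Ad := evmx_det (@A_even n m); have Dd := evmx_det (@D_even n m).
rewrite det_SchurA det_SchurD.
have Po : odmx (minv A *m B) by apply: ev_odmxM; [exact/evmx_inv/A_even|exact: B_odd].
have Qo : odmx (minv D *m C) by apply: ev_odmxM; [exact/evmx_inv/D_even|exact: C_odd].
have e1 p : evmx (1%:M : 'M[R]_p) by exact: evmx1.
set x := \det (1%:M - minv D *m C *m _).
have xe : shomog vp false x by apply/evmx_det/evmxB/odmxM.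
rewrite [\det D * x]even_mulC // -mulrA [\det D * _]mulrA [\det D * _]even_mulC // -(mulrA (\det A)).
rewrite [_ * (\det A * _)]mulrA [x * \det A]even_mulC // -[_ * x * _]mulrA.
congr (_ * _); rewrite [\det D * _]even_mulC //; last by apply/evmx_det/evmxB/odmxM.
by rewrite mulrA det_odd_swap // mul1r.
Qed.

Definition sdet_ser : R := @sdetY n m.
Definition inv_detD : R := sinv vp (\det D : R).

Lemma sdet_serE : sdet_ser = \det schurA * inv_detD.
Proof.
rewrite /sdet_ser /sdetY /inv_detD -toM_SchurA -(toM_blkD n m) -!mxdetE.
by [].
Qed.

Lemma unit_coef0 (f g : R) : f * g = 1 -> f (mon0 _) != 0.
Proof.
move=> fg; apply/eqP => /vanish1P f0.
have /vanish1P := vanishMr g f0; rewrite fg -[LHS]/(if mon0 _ == mon0 _ then 1 else 0) eqxx.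
by move/eqP; rewrite oner_eq0.
Qed.

Lemma ev_det_inv p (M : 'M[R]_p) : evmx M -> mxvanish 1 (1%:M - M) ->
  \det M * \det (minv M) = 1.
Proof.
move=> Me M1; rewrite -ev_det_mulmx //; last exact: evmx_inv.
by rewrite mulmxV_series // ser_det1.
Qed.

(** [sinv] asks for a nonzero constant term; det D has one because it is a unit, with inverse
    det(D^-1). *)
Lemma det_D_inv_detD : \det D * inv_detD = 1 /\ inv_detD * \det D = 1.
Proof. by apply/sinvP/unit_coef0/ev_det_inv; [exact: D_even|exact: D_vanish]. Qed.

Lemma schurA_valid : mxvalid schurA.
Proof.
apply: mxvalidB; first by move=> i j; rewrite A_E; apply: Ymx_valid.
apply: mxvalidM; last by move=> i j; rewrite C_E; apply: Ymx_valid.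
apply: mxvalidM; first by move=> i j; rewrite B_E; apply: Ymx_valid.
by apply: mxvalid_inv => i j; rewrite D_E; apply: Ymx_valid.
Qed.

(** The inverse of [schurA] is the upper left block of Y^-1, and sigma takes Y^-1 to Y^st, whose
    upper left block is the plain transpose of A. *)
Lemma det_sigma_morph_schurA : sigma_morph (\det schurA) * \det A = 1.
Proof.
have := congr1 (map_mx sigma_morph) (mulmxV_series (@schurA_vanish n m)); rewrite map_mxM map_mx1.
have -> : map_mx sigma_morph (minv schurA) = A^T.
  rewrite -(block_mxKul (minv schurA) (- (minv A *m B *m minv schurD))
    (- (minv D *m C *m minv schurA)) (minv schurD)).
  rewrite -Yinvmx_block.
  apply/matrixP => i j; move/matrixP/(_ (lshift m i) (lshift m j)): sigma_morph_Yinvmx.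
  rewrite [LHS]mxE [RHS]mxE !ipar_lshift scale1r => e.
  by rewrite [LHS]mxE [in LHS]mxE [in LHS]mxE [RHS]mxE A_E -e.
have Sae : evmx (map_mx sigma_morph schurA).
  move=> i j; rewrite mxE; apply: sm_shomog; last exact: schurA_even.
    by move=> v; rewrite sm_subst_svar; apply: sigma_img_homog.
  exact: schurA_valid.
move/(congr1 (fun M => \det M)); rewrite ev_det_mulmx // ?ser_det1; last first.
  by move=> i j; rewrite mxE; apply: A_even.
by rewrite ev_det_tr ?det_map_mx //; apply: A_even.
Qed.

(** The lower right block of (Y^-1)^st carries no sign, so sigma takes D to the transposed inverse
    of [schurD]. *)
Lemma sigma_morph_inv_detD : sigma_morph inv_detD = \det schurD.
Proof.
have eD : map_mx sigma_morph D = (minv schurD)^T.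
  apply/matrixP => i j; move/matrixP/(_ (rshift n i) (rshift n j)): (map_sigma_morph_Y n m).
  rewrite [LHS]mxE [RHS]mxE !ipar_rshift scale1r => e.
  by rewrite [LHS]mxE D_E e [RHS]mxE Yinvmx_block block_mxEdr.
have eDet : sigma_morph (\det D) = \det (minv schurD).
  by rewrite -det_map_mx eD ev_det_tr //; apply/evmx_inv/schurD_even.
have e1 : sigma_morph inv_detD * \det (minv schurD) = 1.
  by rewrite -eDet -rmorphM det_D_inv_detD.2 rmorph1.
have e2 : \det schurD * \det (minv schurD) = 1.
  by apply: ev_det_inv; [exact: schurD_even|exact: schurD_vanish].
have e3 : \det (minv schurD) * \det schurD = 1.
  by rewrite even_mulC //; apply/evmx_det; [apply/evmx_inv/schurD_even|apply: schurD_even].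
by rewrite -[RHS]mul1r -e1 -mulrA e3 mulr1.
Qed.

Lemma sigma_sdet : sigma_morph sdet_ser * sdet_ser = 1.
Proof.
rewrite sdet_serE smM sigma_morph_inv_detD mulrA -(mulrA _ (\det schurD)) det_Schur.
by rewrite mulrA det_sigma_morph_schurA mul1r det_D_inv_detD.1.
Qed.

Lemma sigma_valid f : svalid vp (sigma f).
Proof. exact: subst_gen_valid (@sigma_img_valid n m). Qed.

(** Since sigma(sdet) is inverse to sdet, sigma(sdet) - 1 = - sigma(sdet) (sdet - 1): the generator
    of the ideal is sent to a multiple of itself. *)
Lemma sigma_mul_gSL (a : R) :
  sigma_morph (a * (@gSL n m : R)) = - (sigma_morph a * sigma_morph sdet_ser) * (@gSL n m : R).
Proof.
have gE : (@gSL n m : R) = sdet_ser - 1 by [].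
have e : sigma_morph sdet_ser - 1 = - sigma_morph sdet_ser * (sdet_ser - 1).
  by rewrite mulNr mulrBr sigma_sdet mulr1 opprB.
by rewrite smM gE smB sm1 e mulrA mulrN.
Qed.

Lemma inI_eq (f g : R) : f = g -> inI (ssub f g).
Proof.
move=> ->; exists szero; split=> //; transitivity (0 : R); first exact: (@subrr R g).
by symmetry; apply: (@mul0r R).
Qed.

Lemma inI2_eq (f g : R2) : f = g -> inI2 (ssub f g).
Proof.
move=> ->; exists szero, szero; split=> //; transitivity (0 : R2); first exact: (@subrr R2 g).
symmetry; apply: etrans (addr0 (0 : R2)).
by congr (_ + _ : R2); apply: (@mul0r R2).
Qed.

End StructureMaps.

Theorem theorem2p1 (n m : nat) :
  (* sigma is well defined on Hol(SL(n,m,C)) = C[[x]] / (sdet(delta+x) - 1) *)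
  (forall a : ser (V n m), svalid (@vpar n m) a ->
     inI (sigma (smul (@vpar n m) a (@gSL n m)))) /\
  (* sigma is even *)
  (forall (p : bool) (f : ser (V n m)), svalid (@vpar n m) f -> shomog (@vpar n m) p f ->
     exists h : ser (V n m), svalid (@vpar n m) h /\ shomog (@vpar n m) p h /\
       inI (ssub (sigma f) h)) /\
  (* (1) *)
  (forall f : ser (V n m), svalid (@vpar n m) f ->
     inI2 (ssub (sigma2 (Delta f)) (Delta (sigma f)))) /\
  (* (2) *)
  (forall f : ser (V n m), svalid (@vpar n m) f ->
     seps (sigma f) = (seps f)^*) /\
  (* (3) *)
  (forall (l mu : CC) (f g : ser (V n m)), svalid (@vpar n m) f -> svalid (@vpar n m) g ->
     inI (ssub (sigma (sadd (sscale l f) (sscale mu g)))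
               (sadd (sscale l^* (sigma f)) (sscale mu^* (sigma g))))) /\
  (* (4) *)
  (forall f g : ser (V n m), svalid (@vpar n m) f -> svalid (@vpar n m) g ->
     inI (ssub (sigma (smul (@vpar n m) f g)) (smul (@vpar n m) (sigma f) (sigma g)))) /\
  (* (5b) *)
  (forall (p : bool) (f : ser (V n m)), svalid (@vpar n m) f -> shomog (@vpar n m) p f ->
     inI (ssub (Santi (sigma (Santi (sigma f)))) (sscale ((-1) ^+ p) f))) /\
  (* (6b) *)
  (forall (p : bool) (f : ser (V n m)), svalid (@vpar n m) f -> shomog (@vpar n m) p f ->
     inI (ssub (sigma (sigma f)) (sscale ((-1) ^+ p) f))).
Proof.
split=> [a av|].
  exists (- (sigma_morph n m a * sigma_morph n m (@sdet_ser n m)) : sring (@vpar n m)); split.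
    by apply/svalidN/svalidM; apply: sigma_valid.
  exact: sigma_mul_gSL.
split=> [p f fv fp|].
  exists (sigma f); split; first exact: sigma_valid.
  split; last exact: inI_eq.
  apply: (sm_shomog (s := sigma_morph n m)) fv fp => v; rewrite sm_subst_svar.
  exact: sigma_img_homog.
split=> [f fv|]; first exact/inI2_eq/sigma2_Delta.
split=> [f fv|]; first exact: (seps_sm (sigma_morph n m)).
split=> [l mu f g fv gv|].
  apply: inI_eq; pose s := sigma_morph n m.
  transitivity (s (l *: (f : sring _)) + s (mu *: (g : sring _))).
    exact: (rmorphD s).
  by rewrite !smZ.
split=> [f g fv gv|]; first exact/inI_eq/(smM (sigma_morph n m)).
split=> p f fv fp; apply: inI_eq; first exact: S_sigma_S_sigma.
exact: sigma_sigma.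
Qed.
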